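(* Let $A_n$ be a self-adjoint (bounded or unbounded) operator in a Hilbert space $\mathcal H_n$ for each $n\in\overline{\mathbb N}=\{1,2,3,\dots\}\cup\{\infty\}$. Then $(A_n)_{n\in\mathbb N}$ converges to $A_\infty$ in generalised norm resolvent sense of Weidmann if and only if $(A_n)_{n\in\mathbb N}$ QUE-converges to $A_\infty$.
   Context: All Hilbert spaces are complex and separable. $\mathcal L(\mathcal H_1,\mathcal H_2)$ denotes the bounded linear operators, $\mathcal L(\mathcal H)=\mathcal L(\mathcal H,\mathcal H)$, norms are operator norms, $\rho(A)$ is the resolvent set, and $\Gamma:=\bigcap_{n\in\overline{\mathbb N}}\rho(A_n)$. For $z_0\in\Gamma$ write $R_n:=(A_n-z_0)^{-1}$ for $n\in\overline{\mathbb N}$. Weidmann's convergence: $(A_n)_{n\in\mathbb N}$ converges to $A_\infty$ in generalised norm resolvent sense of Weidmann if there exist a Hilbert space $\mathcal H$ (parent space), isometries $\iota_n:\mathcal H_n\to\mathcal H$ for each $n\in\overline{\mathbb N}$, and some $z_0\in\Gamma$ such that $\|\iota_nR_n\iota_n^*-\iota_\infty R_\infty\iota_\infty^*\|_{\mathcal L(\mathcal H)}\to0$ as $n\to\infty$. QUE-convergence: $(A_n)_{n\in\mathbb N}$ QUE-converges to $A_\infty$ (generalised norm resolvent sense based on quasi-unitary equivalence) if there exist $z_0\in\Gamma$, a sequence $\delta_n\ge0$ with $\delta_n\to0$, and bounded operators $J_n:\mathcal H_n\to\mathcal H_\infty$ ($n\in\mathbb N$) such that for all $n\in\mathbb N$: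 (i) $\|J_n\|\le1+\delta_n$; (ii) $\|(\mathrm{id}_{\mathcal H_n}-J_n^*J_n)R_n\|\le\delta_n$ and $\|(\mathrm{id}_{\mathcal H_\infty}-J_nJ_n^* )R_\infty\|\le\delta_n$; (iii) $\|R_\infty J_n-J_nR_n\|\le\delta_n$; and, if $z_0\in\mathbb C\setminus\mathbb R$, (ii) and (iii) also hold with $R_n,R_\infty$ replaced by $R_n^*,R_\infty^*$. *)

(* Defs.v *)
From HB Require Import structures.
From mathcomp Require Import all_boot all_order all_algebra.
From mathcomp Require Import all_classical all_reals all_analysis.
From mathcomp Require Import sesquilinear complex.

Set Implicit Arguments.
Unset Strict Implicit.
Unset Printing Implicit Defensive.

Import Order.TTheory GRing.Theory Num.Theory.
Import numFieldNormedType.Exports.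

Local Open Scope classical_set_scope.
Local Open Scope ring_scope.

(* Inner products are linear in the first argument and conjugate-linear in the
   second one.  The norm of a [normedModType R[i]] takes its values in [R[i]];
   the compatibility axiom is an equality of complex numbers. *)
HB.mixin Record isSeparableHilbert (R : realType) H
    & CompleteNormedModule R[i] H := {
  hdot : {dot H for @Num.conj R[i]} ;
  sqr_norm_hdot : forall x : H, `|x| ^+ 2 = hdot x x ;
  hilbert_separable : exists2 S : set H, countable S & dense S
}.

#[short(type="hilbertType")]
HB.structure Definition SeparableHilbert (R : realType) :=
  {H of CompleteNormedModule R[i] H & isSeparableHilbert R H}.

Section BoundedOperators.
Context {R : realType}.
Local Open Scope ereal_scope.

(* Extended-real valued, so that an unbounded map has norm [+oo]. *)
Definition opnorm (U V : hilbertType R) (T : U -> V) : \bar R :=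
  ereal_sup [set (complex.Re `|T x|)%:E | x in [set x : U | `|x| <= 1]%R].

Definition bounded_op (U V : hilbertType R) (T : U -> V) : Prop :=
  opnorm T < +oo.

(* By the Riesz representation theorem, for bounded linear [T] the set below is
   a singleton. *)
Definition adjoint (U V : hilbertType R) (T : U -> V) : V -> U :=
  fun y => xget 0%R [set z : U | forall x, hdot (T x) y = hdot x z].

Definition isometric (U V : hilbertType R) (T : U -> V) : Prop :=
  forall x, `|T x|%R = `|x|%R.

End BoundedOperators.

Section UnboundedOperators.
Context {R : realType}.

(* The values of [op] outside of [dom] are irrelevant. *)
Record operator (H : hilbertType R) := Operator {
  dom : set H ;
  op :> H -> H ;
  dom0 : dom 0 ;
  dom_linear : forall (a : R[i]) x y, dom x -> dom y -> dom (a *: x + y) ;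
  op_linear : forall (a : R[i]) x y, dom x -> dom y ->
    op (a *: x + y) = a *: op x + op y
}.

Context {H : hilbertType R}.
Implicit Types (A : operator H) (z : R[i]).

Definition graph A : set (H * H) := [set p | dom A p.1 /\ p.2 = A p.1].

(* The graph of the adjoint operator, when [A] is densely defined. *)
Definition adjoint_graph A : set (H * H) :=
  [set p | forall x, dom A x -> hdot (A x) p.1 = hdot x p.2].

Definition self_adjoint A : Prop :=
  dense (dom A) /\ adjoint_graph A = graph A.

Definition resolvent A z : H -> H :=
  'pinv_(fun=> 0) (dom A) (fun x => A x - z *: x).

Definition resolvent_set A : set R[i] :=
  [set z | set_bij (dom A) [set: H] (fun x => A x - z *: x) /\
           bounded_op (resolvent A z)].

End UnboundedOperators.

Section GeneralisedConvergence.
Context {R : realType} {H : nat -> hilbertType R} {Hoo : hilbertType R}.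
Variables (A : forall n, operator (H n)) (Aoo : operator Hoo).

Definition common_resolvent_set : set R[i] :=
  resolvent_set Aoo `&` \bigcap_n resolvent_set (A n).

Definition weidmann_cvg : Prop :=
  exists (K : hilbertType R) (iota : forall n, {linear H n -> K})
         (iotaoo : {linear Hoo -> K}) (z0 : R[i]),
  [/\ forall n, isometric (iota n),
      isometric iotaoo,
      common_resolvent_set z0 &
      opnorm (fun x => iota n (resolvent (A n) z0 (adjoint (iota n) x)) -
                       iotaoo (resolvent Aoo z0 (adjoint iotaoo x)))
        @[n --> \oo] --> 0%E].

(* Conditions (ii) and (iii) of quasi-unitary equivalence, for given operators
   [Rn] and [Roo] in the roles of the resolvents. *)
Definition quasi_unitary_bounds n (J : H n -> Hoo) (d : R)
    (Rn : H n -> H n) (Roo : Hoo -> Hoo) : Prop :=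
  [/\ (opnorm (fun x => (Rn x - adjoint J (J (Rn x)))%R) <= d%:E)%E,
      (opnorm (fun x => (Roo x - J (adjoint J (Roo x)))%R) <= d%:E)%E &
      (opnorm (fun x => (Roo (J x) - J (Rn x))%R) <= d%:E)%E].

Definition que_cvg : Prop :=
  exists (z0 : R[i]) (delta : nat -> R) (J : forall n, {linear H n -> Hoo}),
  [/\ common_resolvent_set z0,
      forall n, 0 <= delta n,
      delta n @[n --> \oo] --> (0 : R) &
      forall n,
      [/\ bounded_op (J n),
          (opnorm (J n) <= (1 + delta n)%:E)%E,
          quasi_unitary_bounds (J n) (delta n)
            (resolvent (A n) z0) (resolvent Aoo z0) &
          z0 \notin Num.real -> quasi_unitary_bounds (J n) (delta n)
            (adjoint (resolvent (A n) z0)) (adjoint (resolvent Aoo z0))]].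

End GeneralisedConvergence.

(* Main.v *)
(** If two isometries into a parent space give close resolvents, then
    [J_n = iota_oo^* iota_n] is quasi-unitary, with [delta_n] the norm of the
    difference of the lifted resolvents.  Conversely, [J_n / (1 + delta_n)] is a
    contraction, and a contraction [J] extends to an isometry
    [x |-> (J x, V x)] as soon as [V^* V = 1 - J^* J]; placing the second
    components in mutually orthogonal slots yields one parent space for all [n].
    With [iota_oo^* iota_n = J] the difference of the lifted resolvents is
    [(1 - P_oo) iota_n R_n iota_n^* + iota_oo (J R_n - R_oo J) iota_n^*
     + iota_oo R_oo (J iota_n^* - iota_oo^* )],
    and the squared norms of the outer terms reduce to
    [<(1 - J^* J) R_n x, R_n x>] and [<(1 - J J^* ) R_oo^* x, R_oo^* x>]. *)
Require Import Defs.
From HB Require Import structures.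
From mathcomp Require Import all_boot all_order all_algebra.
From mathcomp Require Import all_classical all_reals all_analysis.
From mathcomp Require Import sesquilinear complex.
From mathcomp Require Import ring lra.

Set Implicit Arguments.
Unset Strict Implicit.
Unset Printing Implicit Defensive.

Import Order.TTheory GRing.Theory Num.Theory.
Import numFieldNormedType.Exports.

Local Open Scope classical_set_scope.
Local Open Scope ring_scope.
Local Open Scope complex_scope.

Local Notation Re := complex.Re.
Local Notation Im := complex.Im.

(** * Real and imaginary parts *)

Section ComplexNumbers.
Context {R : realType}.
Implicit Types a b : R[i].

Lemma ReDc a b : Re (a + b) = Re a + Re b.
Proof. by case: a; case: b. Qed.

Lemma ReNc a : Re (- a) = - Re a.
Proof. by case: a. Qed.

Lemma ImDc a b : Im (a + b) = Im a + Im b.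
Proof. by case: a; case: b. Qed.

Lemma ReMc a b : Re (a * b) = Re a * Re b - Im a * Im b.
Proof. by case: a; case: b. Qed.

Lemma ImMc a b : Im (a * b) = Re a * Im b + Im a * Re b.
Proof. by case: a; case: b. Qed.

Lemma conjCE a : Num.conj a = (Re a -i* Im a).
Proof. by case: a. Qed.

Lemma complex_ext a b : Re a = Re b -> Im a = Im b -> a = b.
Proof. by case: a => a1 a2; case: b => b1 b2 /= -> ->. Qed.

Lemma ge0_ReK a : 0 <= a -> a = (Re a)%:C.
Proof. by case: a => x y; rewrite lecE /= => /andP[/eqP -> _]. Qed.

End ComplexNumbers.

(** * Real-valued norm and real part of the inner product *)

Section HilbertBasics.
Context {R : realType} {H : hilbertType R}.
Implicit Types (x y z : H) (a : R[i]).

(** The norm takes its values in [R[i]]; [hn] and [rdot] move all estimates and limits to the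
    ordered field [R]. *)
Definition hn x : R := Re `|x|.
Definition rdot x y : R := Re (hdot x y).

Lemma normE x : `|x| = (hn x)%:C.
Proof. exact: ge0_ReK. Qed.

Lemma hn_ge0 x : 0 <= hn x.
Proof. by rewrite -ler0c -normE. Qed.

Lemma hn0 : hn (0 : H) = 0.
Proof. by rewrite /hn normr0. Qed.

Lemma hn_eq0 x : hn x = 0 -> x = 0.
Proof. by move=> h; apply/normr0_eq0; rewrite normE h. Qed.

Lemma hnN x : hn (- x) = hn x.
Proof. by rewrite /hn normrN. Qed.

Lemma hnC x y : hn (x - y) = hn (y - x).
Proof. by rewrite /hn distrC. Qed.

Lemma hnD x y : hn (x + y) <= hn x + hn y.
Proof. by rewrite -lecR rmorphD /= -!normE ler_normD. Qed.

Lemma hnB x y : hn (x - y) <= hn x + hn y.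
Proof. by rewrite -(hnN y) hnD. Qed.

Lemma hn_tri y x z : hn (x - z) <= hn (x - y) + hn (y - z).
Proof. by rewrite (_ : x - z = (x - y) + (y - z)) ?hnD// addrA subrK. Qed.

Lemma hnZ a x : hn (a *: x) = Re `|a| * hn x.
Proof. by rewrite /hn normrZ ReMc (normE x) /= mulr0 subr0. Qed.

Lemma hnZr (t : R) x : hn (t%:C *: x) = `|t| * hn x.
Proof. by rewrite hnZ normc_def /= expr0n /= addr0 sqrtr_sqr. Qed.

Lemma hdotC x y : hdot x y = Num.conj (hdot y x).
Proof. by have := hermC hdot x y; rewrite expr0 mul1r. Qed.

Lemma hdotDl x y z : hdot (x + y) z = hdot x z + hdot y z.
Proof. exact: linearDl. Qed.
Lemma hdotDr x y z : hdot z (x + y) = hdot z x + hdot z y.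
Proof. exact: linearDr. Qed.
Lemma hdotZl a x y : hdot (a *: x) y = a * hdot x y.
Proof. by rewrite linearZl_LR. Qed.
Lemma hdotZr a x y : hdot x (a *: y) = Num.conj a * hdot x y.
Proof. by rewrite linearZr_LR. Qed.

Lemma rdotC x y : rdot x y = rdot y x.
Proof. by rewrite /rdot hdotC; case: (hdot y x). Qed.

Lemma rdotDl x y z : rdot (x + y) z = rdot x z + rdot y z.
Proof. by rewrite /rdot hdotDl ReDc. Qed.
Lemma rdotDr x y z : rdot z (x + y) = rdot z x + rdot z y.
Proof. by rewrite /rdot hdotDr ReDc. Qed.
Lemma rdotNl x y : rdot (- x) y = - rdot x y.
Proof. by rewrite /rdot linearNl ReNc. Qed.
Lemma rdotNr x y : rdot x (- y) = - rdot x y.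
Proof. by rewrite /rdot linearNr ReNc. Qed.
Lemma rdotBl x y z : rdot (x - y) z = rdot x z - rdot y z.
Proof. by rewrite rdotDl rdotNl. Qed.
Lemma rdotBr x y z : rdot z (x - y) = rdot z x - rdot z y.
Proof. by rewrite rdotDr rdotNr. Qed.
Lemma rdotZl (t : R) x y : rdot (t%:C *: x) y = t * rdot x y.
Proof. by rewrite /rdot hdotZl ReMc /= mul0r subr0. Qed.
Lemma rdotZr (t : R) x y : rdot x (t%:C *: y) = t * rdot x y.
Proof. by rewrite rdotC rdotZl rdotC. Qed.
Lemma rdot0l x : rdot 0 x = 0.
Proof. by rewrite /rdot linear0l. Qed.
Lemma rdot0r x : rdot x 0 = 0.
Proof. by rewrite rdotC rdot0l. Qed.

Lemma Im_hdot x y : Im (hdot x y) = rdot x ('i *: y).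
Proof. by rewrite /rdot hdotZr conjCE ReMc /= mul0r mulN1r sub0r opprK. Qed.

Lemma sqr_hn x : hn x ^+ 2 = rdot x x.
Proof.
by rewrite /rdot -sqr_norm_hdot (normE x) expr2 ReMc /= mul0r subr0 -expr2.
Qed.

Lemma sqr_hnD x y : hn (x + y) ^+ 2 = hn x ^+ 2 + 2 * rdot x y + hn y ^+ 2.
Proof. rewrite !sqr_hn rdotDl !rdotDr (rdotC y x); ring. Qed.

Lemma sqr_hnB x y : hn (x - y) ^+ 2 = hn x ^+ 2 - 2 * rdot x y + hn y ^+ 2.
Proof. rewrite sqr_hnD rdotNr hnN; ring. Qed.

End HilbertBasics.

(** The imaginary part of an inner product is a real part after rotating the second argument by
    ['i], so identities between complex inner products reduce to [rdot]. *)
Lemma rdot_hdot {R : realType} {H H' : hilbertType R} (x y : H) (x' y' : H') :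
  rdot x y = rdot x' y' -> rdot x ('i *: y) = rdot x' ('i *: y') ->
  hdot x y = hdot x' y'.
Proof. by move=> ? ?; apply: complex_ext; rewrite ?Im_hdot. Qed.

(** * The Cauchy-Schwarz inequality *)

Section RealInequalities.
Context {R : realType}.

(** A nonnegative real quadratic has nonpositive discriminant. The abstract form serves [rdot] and
    [l2rdot], and with [a = 0] the proof of [riesz]. *)
Lemma quadratic_CS (a b c : R) : 0 <= a -> 0 <= c ->
  (forall t : R, 0 <= a ^+ 2 + 2 * t * b + t ^+ 2 * c ^+ 2) -> b <= a * c.
Proof.
move=> a0 c0 h; have [c00|cN0] := eqVneq c 0.
  have [b0|bp] := leP b 0; first by rewrite c00 mulr0.
  (* For [c = 0] the polynomial is affine; at this point its value is [- a ^+ 2 - 2]. *)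
  have := h (- (a ^+ 2 + 1) / b); rewrite c00 expr0n mulr0 addr0.
  rewrite (_ : 2 * _ * b = - 2 * (a ^+ 2 + 1)); last by field; rewrite gt_eqF.
  by have := sqr_ge0 a; lra.
have cp : 0 < c by rewrite lt_def cN0.
have [//|lt_b] := leP b (a * c); exfalso.
have := h (- a / c).
rewrite (_ : _ + _ = 2 * (a / c) * (a * c - b)); last by field.
apply/negP; rewrite -ltNge.
(* If [a = 0], the vertex [- b / c ^+ 2] already gives the negative value [- (b / c) ^+ 2]. *)
have ap : 0 < a.
  rewrite lt_def a0 andbT; apply/eqP => a00.
  have := h (- b / c ^+ 2); rewrite a00 expr0n add0r.
  rewrite (_ : _ + _ = - (b / c) ^+ 2); last by field.
  have : 0 < (b / c) ^+ 2.
    by rewrite exprn_gt0// divr_gt0//; rewrite a00 mul0r in lt_b.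
  by lra.
by rewrite pmulr_rlt0 ?subr_lt0// mulr_gt0// divr_gt0.
Qed.

End RealInequalities.

Section CauchySchwarz.
Context {R : realType} {H : hilbertType R}.
Implicit Types (x y : H).

Lemma rdot_CS x y : rdot x y <= hn x * hn y.
Proof.
apply: quadratic_CS; rewrite ?hn_ge0// => t.
have := sqr_ge0 (hn (x + t%:C *: y)).
by rewrite sqr_hnD rdotZr hnZr exprMn real_normK ?num_real// mulrA.
Qed.

Lemma normr_rdot_CS x y : `|rdot x y| <= hn x * hn y.
Proof.
by rewrite ler_norml rdot_CS andbT lerNl -rdotNl -(hnN x) rdot_CS.
Qed.

End CauchySchwarz.

(** * Sequential completeness *)

Section Completeness.
Context {R : realType}.

Lemma ltr0c (t : R) : (0 < t%:C) = (0 < t).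
Proof. exact: ltcR. Qed.

Lemma gt0_ReK (e : R[i]) : 0 < e -> 0 < Re e /\ e = (Re e)%:C.
Proof.
by move=> e0; have := ge0_ReK (ltW e0) => ee; rewrite -ltcR -ee.
Qed.

(* A Cauchy filter converges as soon as Cauchy sequences do: pick points
   whose balls of radius [n.+1^-1] belong to the filter. *)
Lemma complete_of_sequences (V : normedModType R[i]) :
  (forall u : nat -> V,
    (forall e : R, 0 < e -> exists N, forall m n, (N <= m)%N -> (N <= n)%N ->
       `|u m - u n| <= e%:C) ->
    exists l, forall e : R, 0 < e -> exists N, forall n, (N <= n)%N ->
       `|u n - l| <= e%:C) ->
  forall F : set_system V, ProperFilter F -> cauchy F -> cvg F.
Proof.
move=> Vseq F PF /cauchyP cF.
have /choice[u uF] (n : nat) : exists x, F (ball x (n.+1%:R^-1 : R)%:C).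
  by apply: cF; rewrite ltr0c invr_gt0.
have invn (e : R) : 0 < e -> exists N, forall n, (N <= n)%N -> n.+1%:R^-1 <= e.
  move=> e0; exists (Num.bound e^-1) => n Nn.
  rewrite invf_ple ?posrE//.
  have : e^-1 < (Num.bound e^-1)%:R by rewrite archi_boundP// invr_ge0 ltW.
  move=> /ltW/le_trans; apply; rewrite ler_nat; exact: leqW.
have dist2 m n : `|u m - u n| <= (m.+1%:R^-1 + n.+1%:R^-1 : R)%:C.
  have [x [xm xn]] := filter_ex (filterI (uF m) (uF n)).
  rewrite (_ : u m - u n = (u m - x) - (u n - x)); last first.
    by rewrite opprB addrA subrK.
  rewrite rmorphD/= (le_trans (ler_normB _ _))// lerD//.
    by move: xm; rewrite -ball_normE/= => /ltW.
  by move: xn; rewrite -ball_normE/= => /ltW.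
have [|l ul] := Vseq u.
  move=> e e0; have [|N Ne] := invn (e / 2); first by rewrite divr_gt0.
  exists N => m n /Ne m2 /Ne n2; rewrite (le_trans (dist2 _ _))// lecR.
  by rewrite [e]splitr lerD.
apply/cvg_ex; exists l; apply/cvgrPdist_le => e' /gt0_ReK[e0 ->].
set e := Re e' in e0 *.
have [|N1 N1e] := invn (e / 2); first by rewrite divr_gt0.
have [|N2 N2e] := ul (e / 2); first by rewrite divr_gt0.
pose n := maxn N1 N2.
have := uF n; apply: filterS => x; rewrite -ball_normE/= => xn.
rewrite (_ : l - x = (u n - x) - (u n - l)); last first.
  by rewrite opprB [RHS]addrC addrA subrK.
rewrite (le_trans (ler_normB _ _))// [e]splitr rmorphD/= lerD//.
  by rewrite (le_trans (ltW xn))// lecR N1e// leq_maxl.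
by rewrite N2e// leq_maxr.
Qed.

Lemma hn_complete (H : hilbertType R) (u : nat -> H) :
  (forall e : R, 0 < e -> exists N, forall m n, (N <= m)%N -> (N <= n)%N ->
    hn (u m - u n) <= e) ->
  exists l, hn (u n - l) @[n --> \oo] --> (0 : R).
Proof.
move=> cu; have : cauchy (u @ \oo).
  apply/cauchyP => e' /gt0_ReK[e0 ->]; set e := Re e' in e0 *.
  have [|N Ne] := cu (e / 2); first by rewrite divr_gt0.
  exists (u N); exists N => //= n /= Nn; rewrite -ball_normE/= normE ltcR.
  by rewrite (le_lt_trans (Ne _ _ _ _))//; lra.
move=> /cauchy_cvg/cvg_ex[l /cvgrPdist_le ul]; exists l.
apply/cvgrPdist_le => e e0; have := ul (e%:C); rewrite ltr0c => /(_ e0).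
apply: filterS => n; rewrite normE lecR sub0r normrN ger0_norm ?hn_ge0//.
by rewrite hnC.
Qed.

End Completeness.

(** * Continuity of the norm and the inner product along sequences *)

Section Convergence.
Context {R : realType} {H : hilbertType R}.
Implicit Types (u v : nat -> H) (x y : H).

Lemma hn_lip x y : `|hn x - hn y| <= hn (x - y).
Proof.
rewrite ler_distl; apply/andP; split.
  by rewrite lerBlDr -(hnC y) -lerBlDl; have := hn_tri x y 0; rewrite !subr0; lra.
by have := hn_tri y x 0; rewrite !subr0; lra.
Qed.

Lemma cvg_hnB u l x : hn (u n - l) @[n --> \oo] --> (0 : R) ->
  hn (u n - x) @[n --> \oo] --> hn (l - x).
Proof.
move=> ul; apply/cvgrPdist_le => e e0.
move/cvgrPdist_le : ul => /(_ _ e0); apply: filterS => n.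
rewrite sub0r normrN ger0_norm ?hn_ge0// => le_e.
rewrite distrC (le_trans (hn_lip _ _))//.
by rewrite opprB addrA subrK.
Qed.

Lemma cvg_rdot u l x : hn (u n - l) @[n --> \oo] --> (0 : R) ->
  rdot (u n) x @[n --> \oo] --> rdot l x.
Proof.
move=> ul; apply/cvgrPdist_le => e e0.
have x0 := hn_ge0 x.
(* Adding [1] keeps the divisor positive when [x = 0]. *)
have e'0 : 0 < e / (hn x + 1) by rewrite divr_gt0//; lra.
move/cvgrPdist_le : ul => /(_ _ e'0); apply: filterS => n.
rewrite sub0r normrN ger0_norm ?hn_ge0// ler_pdivlMr; last by lra.
rewrite -rdotBl => le_e; apply: le_trans (normr_rdot_CS _ _) _.
rewrite hnC; have := hn_ge0 (u n - l); nra.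
Qed.

End Convergence.

(** * Riesz representation and adjoints *)

Section Riesz.
Context {R : realType} {H : hilbertType R}.
Variables (f : H -> R) (C : R).
Hypotheses (fD : forall x y, f (x + y) = f x + f y)
  (fZ : forall (t : R) x, f (t%:C *: x) = t * f x)
  (fC : forall x, `|f x| <= C * hn x).

Let phi x := hn x ^+ 2 - 2 * f x.

Let phi_ge x : - C ^+ 2 <= phi x.
Proof.
have := ler_norm (f x); have := fC x; have := sqr_ge0 (hn x - C).
rewrite /phi sqrrB; lra.
Qed.

Let phi_has_inf : has_inf (range phi).
Proof. by split; [exists (phi 0), 0|exists (- C ^+ 2) => _ [x _ <-]]. Qed.

Let m := inf (range phi).

Let m_le x : m <= phi x.
Proof. by apply: ge_inf; [case: phi_has_inf|exists x]. Qed.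

(** The value of [phi] at the midpoint of [x] and [y] is at least [m]; the parallelogram identity
    turns this into a bound on the distance of near-minimisers. *)
Let phi_parallelogram x y : hn (x - y) ^+ 2 <= 2 * (phi x + phi y - 2 * m).
Proof.
have := m_le ((2^-1)%:C *: (x + y)).
rewrite /phi hnZr fZ fD exprMn real_normK ?num_real// sqr_hnB sqr_hnD; lra.
Qed.

(* The representing vector minimises [|x|^2 - 2 f x]; minimising sequences are
   Cauchy by the parallelogram identity. *)
Lemma riesz : exists z, forall x, f x = rdot x z.
Proof.
have /choice[u um] (n : nat) : exists x, phi x < m + n.+1%:R^-1.
  have [|_ [x _ <-] xm] := @inf_adherent _ (range phi) n.+1%:R^-1 _ phi_has_inf.
    by rewrite invr_gt0.
  by exists x.
have [e e0|z uz] := @hn_complete _ _ u.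
  (* Two values of [phi] within [e ^+ 2 / 4] of [m] give a squared distance of at most [e ^+ 2]. *)
  have e4 : 0 < e ^+ 2 / 4 by rewrite divr_gt0// exprn_gt0.
  have /cvgrPdist_le /(_ _ e4)[N _ Ne] := @cvg_harmonic R.
  have lee n : (N <= n)%N -> n.+1%:R^-1 <= e ^+ 2 / 4 :> R.
    by move=> /Ne; rewrite /harmonic/= sub0r normrN ger0_norm.
  exists N => p q /lee pe /lee qe.
  rewrite -(@ler_pXn2r _ 2)// ?nnegrE ?hn_ge0 ?(ltW e0)//.
  rewrite (le_trans (phi_parallelogram _ _))//.
  by move: (um p) (um q) pe qe; move: p.+1%:R^-1 q.+1%:R^-1 => a b; lra.
(* Minimality is tested on the perturbations [u n + t x] and passed to the limit; the harmonic term
   absorbs [phi (u n) - m]. *)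
have ineq x (t : R) : 0 <= 2 * t * (rdot z x - f x) + t ^+ 2 * hn x ^+ 2.
  have cv : 2 * t * (rdot (u n) x - f x) + t ^+ 2 * hn x ^+ 2 + harmonic n
      @[n --> \oo] --> 2 * t * (rdot z x - f x) + t ^+ 2 * hn x ^+ 2 + 0.
    apply: cvgD; last exact: cvg_harmonic.
    apply: cvgD; last exact: cvg_cst.
    apply: cvgM; first exact: cvg_cst.
    apply: cvgB; last exact: cvg_cst.
    exact: cvg_rdot.
  rewrite -[leRHS]addr0; apply: (cvgr_to_ge cv); apply: nearW => n.
  have := m_le (u n + t%:C *: x); have := um n; rewrite /phi /harmonic/=.
  rewrite fD fZ sqr_hnD rdotZr hnZr exprMn real_normK ?num_real//.
  by move: (_.+1%:R^-1) => h; lra.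
(* The polynomial in [t] has no constant term, which bounds its linear coefficient by [0]; replacing
   [x] by [- x] later gives equality. *)
have le0 x : rdot z x - f x <= 0.
  rewrite -(mul0r (hn x)); apply: quadratic_CS; rewrite ?hn_ge0// => t.
  by rewrite expr0n add0r.
exists z => x; apply/eqP; rewrite rdotC eq_le.
have f1 y : f (- y) = - f y.
  by have := fZ (-1) y; rewrite rmorphN1 scaleN1r mulN1r.
have := le0 (- x); have := le0 x; rewrite rdotNr f1 => h1 h2.
by apply/andP; split; lra.
Qed.

End Riesz.

(** * Bounded linear operators and their adjoints *)

Section Operators.
Context {R : realType}.
Implicit Types U V : hilbertType R.

(** A bound on all vectors with a real constant composes more easily than the extended-real supremum
    over the unit ball; [opnorm_le] and [opnorm_bound] translate between the two for linear maps and
    [0 <= c]. *)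
Definition op_bound U V (T : U -> V) (c : R) := forall x, hn (T x) <= c * hn x.

Lemma linear_add U V (T : U -> V) x y : linear T -> T (x + y) = T x + T y.
Proof. by move=> lT; have := lT 1 x y; rewrite !scale1r. Qed.

Lemma linear_zero U V (T : U -> V) : linear T -> T 0 = 0.
Proof.
by move=> lT; have := lT (-1) 0 0; rewrite !scaleN1r !addNr.
Qed.

Lemma linear_scale U V (T : U -> V) a x : linear T -> T (a *: x) = a *: T x.
Proof. by move=> lT; have := lT a x 0; rewrite (linear_zero lT) !addr0. Qed.

Lemma linear_sub U V (T : U -> V) x y : linear T -> T (x - y) = T x - T y.
Proof.
by move=> lT; rewrite linear_add// -scaleN1r linear_scale// scaleN1r.
Qed.

Lemma opnorm_le U V (T : U -> V) c : 0 <= c -> op_bound T c ->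
  (opnorm T <= c%:E)%E.
Proof.
move=> c0 Tc; apply: ge_ereal_sup => _ [x /= x1 <-]; rewrite lee_fin.
apply: le_trans (Tc x) _; rewrite ler_piMr//.
by move: x1; rewrite normE -[1]/(1%:C) lecR.
Qed.

Lemma le_opnorm U V (T : U -> V) x : `|x| <= 1 -> ((hn (T x))%:E <= opnorm T)%E.
Proof. by move=> x1; apply: ereal_sup_ubound; exists x. Qed.

Lemma opnorm_ge0 U V (T : U -> V) : (0 <= opnorm T)%E.
Proof.
apply: le_trans (@le_opnorm _ _ T 0 _); first by rewrite lee_fin hn_ge0.
by rewrite normr0.
Qed.

Lemma opnorm_bound U V (T : U -> V) c : linear T -> (opnorm T <= c%:E)%E ->
  op_bound T c.
Proof.
move=> lT Tc x; have [x0|xN0] := eqVneq (hn x) 0.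
  by rewrite (hn_eq0 x0) (linear_zero lT) !hn0 mulr0.
have xp : 0 < hn x by rewrite lt_def xN0 hn_ge0.
have := @le_opnorm _ _ T ((hn x)^-1%:C *: x).
rewrite normE linear_scale// !hnZr gtr0_norm ?invr_gt0// mulVf// lexx.
move=> /(_ isT)/le_trans/(_ Tc); rewrite lee_fin mulrC ler_pdivrMr//.
Qed.

Lemma bounded_opP U V (T : U -> V) : linear T -> bounded_op T ->
  exists2 c, 0 <= c & op_bound T c.
Proof.
move=> lT; rewrite /bounded_op => Too; have T0 := opnorm_ge0 T.
have Tfin : opnorm T \is a fin_num by rewrite ge0_fin_numE.
exists (fine (opnorm T)); first exact: fine_ge0.
by apply: opnorm_bound => //; rewrite fineK.
Qed.

Lemma rdot_i U (x y : U) : rdot x ('i *: y) = - rdot ('i *: x) y.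
Proof.
rewrite /rdot hdotZl hdotZr conjCE !ReMc /=; ring.
Qed.

Lemma hdot_ext U (y z : U) : (forall x, hdot x y = hdot x z) -> y = z.
Proof.
move=> yz; apply/subr0_eq/hn_eq0/eqP; rewrite -sqrf_eq0 sqr_hn rdotBr.
by rewrite /rdot yz subrr.
Qed.

Section Adjoint.
Context {U V : hilbertType R} (T : U -> V) (c : R).
Hypotheses (lT : linear T) (Tc : op_bound T c).

(** The default value of [xget] would be taken only if no representing vector existed. [riesz]
    represents the real part of the functional, and complex linearity of [T] extends this to the
    whole inner product. *)
Lemma hdot_adjoint x y : hdot (T x) y = hdot x (adjoint T y).
Proof.
rewrite /adjoint; case: xgetP => [z _ /(_ x)//|no]; exfalso.
have [x1 x2|t x1|x1|z fz] := @riesz _ _ (fun x => rdot (T x) y) (c * hn y).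
- by rewrite linear_add// rdotDl.
- by rewrite linear_scale// rdotZl.
- apply: le_trans (normr_rdot_CS _ _) _.
  by rewrite mulrAC ler_wpM2r ?hn_ge0.
apply: (no z) => x1; apply: rdot_hdot => //.
by rewrite !rdot_i -linear_scale// -fz.
Qed.

Lemma hdot_adjointC x y : hdot (adjoint T y) x = hdot y (T x).
Proof. by rewrite hdotC -hdot_adjoint -hdotC. Qed.

Lemma rdot_adjoint x y : rdot (T x) y = rdot x (adjoint T y).
Proof. by rewrite /rdot hdot_adjoint. Qed.

Lemma linear_adjoint : linear (adjoint T).
Proof.
move=> a x y; apply: hdot_ext => z.
by rewrite -hdot_adjoint !hdotDr !hdotZr !hdot_adjoint.
Qed.

(** Write the squared norm of [T^* y] as the real part of [<T T^* y, y>], apply Cauchy-Schwarz and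
    cancel one factor. *)
Lemma adjoint_bound : 0 <= c -> op_bound (adjoint T) c.
Proof.
move=> c0 y; have [->|yN0] := eqVneq (hn (adjoint T y)) 0.
  by rewrite mulr_ge0 ?hn_ge0.
rewrite -(ler_pM2r (_ : 0 < hn (adjoint T y))) ?lt_def ?yN0 ?hn_ge0// -expr2.
rewrite sqr_hn -rdot_adjoint mulrAC (le_trans (rdot_CS _ _))//.
by rewrite ler_wpM2r ?hn_ge0.
Qed.

End Adjoint.

End Operators.

(** * Hilbert sum of a sequence of Hilbert spaces *)

Section Series.
Context {R : realType}.
Implicit Types u v : nat -> R.

Lemma is_cvg_nneg_series u (M : R) : (forall k, 0 <= u k) ->
  (forall n, series u n <= M) -> cvgn (series u).
Proof.
move=> u0 uM; apply: nondecreasing_is_cvgn.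
  by apply: nondecreasing_series => n _ _.
by exists M => _ [n _ <-].
Qed.

Lemma nneg_series_le_lim u n : (forall k, 0 <= u k) -> cvgn (series u) ->
  series u n <= limn (series u).
Proof.
move=> u0 cu; apply: nondecreasing_cvgn_le => //.
by apply: nondecreasing_series => k _ _.
Qed.

Lemma is_cvg_series_abs_le u v : (forall k, `|u k| <= v k) ->
  cvgn (series v) -> cvgn (series u).
Proof.
move=> uv cv; apply: normed_cvg; apply: series_le_cvg cv => // n; rewrite ?normr_ge0//.
exact: le_trans (normr_ge0 _) (uv n).
Qed.

Lemma series_single (k : nat) (u : nat -> R) (n : nat) :
  (forall j, j != k -> u j = 0) -> series u n = if (k < n)%N then u k else 0.
Proof.
move=> u0; rewrite /series/=; elim: n => [|n IHn].
  by rewrite big_geq.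
rewrite big_nat_recr//= IHn ltnS [(k <= n)%N]leq_eqVlt.
have [kn|nk] := eqVneq k n; first by rewrite -kn ltnn add0r.
by rewrite (u0 n) 1?eq_sym// addr0.
Qed.

End Series.

Section L2Sum.
Context {R : realType}.
Variable G : nat -> hilbertType R.
Implicit Types f g : forall k, G k.

Definition square_summable f := cvgn (series (fun k => hn (f k) ^+ 2)).

(** The summand may depend on the index, so that a single sum can hold [Hoo] together with a
    separate space for every [n]. *)
Record l2sum := L2Sum { l2val :> forall k, G k ; l2valP : square_summable l2val }.

Lemma l2sum_ext (f g : l2sum) : (forall k, f k = g k) -> f = g.
Proof.
case: f => f fP; case: g => g gP /= fg.
have {}fg : f = g by apply: functional_extensionality_dep.
by rewrite fg in fP *; congr L2Sum; exact: Prop_irrelevance.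
Qed.

Lemma square_summable_le f (u : nat -> R) :
  (forall k, hn (f k) ^+ 2 <= u k) -> cvgn (series u) -> square_summable f.
Proof.
by move=> fu; apply: is_cvg_series_abs_le => k; rewrite ger0_norm ?sqr_ge0.
Qed.

Lemma square_summable0 : square_summable (fun=> 0).
Proof.
apply: (@is_cvg_nneg_series _ _ 0) => [k|n]; first exact: sqr_ge0.
by rewrite /series/= big1// => k _; rewrite hn0 expr0n.
Qed.

Lemma square_summableN f : square_summable f -> square_summable (fun k => - f k).
Proof. by apply: square_summable_le => k; rewrite hnN. Qed.

Lemma square_summableD f g : square_summable f -> square_summable g ->
  square_summable (fun k => f k + g k).
Proof.
move=> cf cg.
apply: (@square_summable_le _
  (2 *: ((fun k => hn (f k) ^+ 2) + (fun k => hn (g k) ^+ 2)) : nat -> R)).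
  move=> k; rewrite -[leRHS]/(2 * (hn (f k) ^+ 2 + hn (g k) ^+ 2)).
  have := sqr_ge0 (hn (f k) - hn (g k)); rewrite sqrrB sqr_hnD.
  by have := rdot_CS (f k) (g k); lra.
by apply: is_cvg_seriesZ; rewrite seriesD; exact: is_cvgD.
Qed.

Lemma square_summableZ a f : square_summable f -> square_summable (fun k => a *: f k).
Proof.
move=> cf; apply: (@square_summable_le _
  (Re `|a| ^+ 2 *: (fun k => hn (f k) ^+ 2) : nat -> R)).
  by move=> k; rewrite hnZ exprMn.
exact: is_cvg_seriesZ.
Qed.

HB.instance Definition _ := gen_eqMixin l2sum.
HB.instance Definition _ := gen_choiceMixin l2sum.

Definition l2zero := L2Sum square_summable0.
Definition l2opp (f : l2sum) := L2Sum (square_summableN (@l2valP f)).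
Definition l2add (f g : l2sum) := L2Sum (square_summableD (@l2valP f) (@l2valP g)).
Definition l2scale a (f : l2sum) := L2Sum (@square_summableZ a _ (@l2valP f)).

Lemma l2addA : associative l2add.
Proof. by move=> f g h; apply: l2sum_ext => k /=; rewrite addrA. Qed.
Lemma l2addC : commutative l2add.
Proof. by move=> f g; apply: l2sum_ext => k /=; rewrite addrC. Qed.
Lemma l2add0 : left_id l2zero l2add.
Proof. by move=> f; apply: l2sum_ext => k /=; rewrite add0r. Qed.
Lemma l2addN : left_inverse l2zero l2opp l2add.
Proof. by move=> f; apply: l2sum_ext => k /=; rewrite addNr. Qed.

HB.instance Definition _ := GRing.isZmodule.Build l2sum l2addA l2addC l2add0 l2addN.

Lemma l2scaleA a b (f : l2sum) : l2scale a (l2scale b f) = l2scale (a * b) f.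
Proof. by apply: l2sum_ext => k /=; rewrite scalerA. Qed.
Lemma l2scale1 : left_id 1 l2scale.
Proof. by move=> f; apply: l2sum_ext => k /=; rewrite scale1r. Qed.
Lemma l2scaleDr : right_distributive l2scale +%R.
Proof. by move=> a f g; apply: l2sum_ext => k /=; rewrite scalerDr. Qed.
Lemma l2scaleDl (f : l2sum) : {morph l2scale^~ f : a b / a + b}.
Proof. by move=> a b; apply: l2sum_ext => k /=; rewrite scalerDl. Qed.

HB.instance Definition _ :=
  GRing.Zmodule_isLmodule.Build R[i] l2sum l2scaleA l2scale1 l2scaleDr l2scaleDl.

Implicit Types F K : l2sum.

Definition l2rdot F K : R := limn (series (fun k => rdot (F k) (K k))).

Lemma cvg_l2rdot F K :
  series (fun k => rdot (F k) (K k)) @ \oo --> l2rdot F K.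
Proof.
suff : cvgn (series (fun k => rdot (F k) (K k))) by [].
apply: (@is_cvg_series_abs_le _ _
  ((fun k => hn (F k) ^+ 2) + (fun k => hn (K k) ^+ 2) : nat -> R)); last first.
  by rewrite seriesD; apply: is_cvgD; exact: l2valP.
move=> k /=; apply: le_trans (normr_rdot_CS _ _) _.
rewrite -[leRHS]/(hn (F k) ^+ 2 + hn (K k) ^+ 2).
have := sqr_ge0 (hn (F k) - hn (K k)); rewrite sqrrB.
by have := hn_ge0 (F k); have := hn_ge0 (K k); nra.
Qed.

Lemma l2rdotE F K l : series (fun k => rdot (F k) (K k)) @ \oo --> l ->
  l2rdot F K = l.
Proof. by move/cvg_lim; apply. Qed.

Lemma l2rdotC F K : l2rdot F K = l2rdot K F.
Proof. by congr (limn (series _)); apply/funext => k; rewrite rdotC. Qed.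

Lemma l2rdotDl F F' K : l2rdot (F + F') K = l2rdot F K + l2rdot F' K.
Proof.
apply: l2rdotE.
have -> : (fun k => rdot ((F + F') k) (K k)) =
    (fun k => rdot (F k) (K k)) + (fun k => rdot (F' k) (K k)).
  by apply/funext => k; rewrite rdotDl.
by rewrite seriesD; apply: cvgD; exact: cvg_l2rdot.
Qed.

Lemma l2rdotZl (t : R) F K : l2rdot (t%:C *: F) K = t * l2rdot F K.
Proof.
apply: l2rdotE.
have -> : series (fun k => rdot ((t%:C *: F) k) (K k)) =
    (fun n => t * series (fun k => rdot (F k) (K k)) n).
  apply/funext => n; rewrite /series/= mulr_sumr.
  by apply: eq_bigr => k _; rewrite rdotZl.
by apply: cvgMl_tmp; exact: cvg_l2rdot.
Qed.

Lemma l2rdotNl F K : l2rdot (- F) K = - l2rdot F K.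
Proof. by rewrite -scaleN1r -[-1](rmorphN1 (real_complex R)) l2rdotZl mulN1r. Qed.

Lemma l2rdotDr F F' K : l2rdot K (F + F') = l2rdot K F + l2rdot K F'.
Proof. by rewrite !(l2rdotC K) l2rdotDl. Qed.

Lemma l2rdotZr (t : R) F K : l2rdot F (t%:C *: K) = t * l2rdot F K.
Proof. by rewrite !(l2rdotC F) l2rdotZl. Qed.

Lemma l2rdot_i F K : l2rdot ('i *: F) K = - l2rdot F ('i *: K).
Proof.
rewrite -mulN1r -l2rdotZr; congr (limn (series _)); apply/funext => k /=.
by rewrite rdotZr mulN1r rdot_i opprK.
Qed.

Definition l2sqr F : R := limn (series (fun k => hn (F k) ^+ 2)).

Lemma l2sqrE F : l2sqr F = l2rdot F F.
Proof. by congr (limn (series _)); apply/funext => k; rewrite sqr_hn. Qed.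

Lemma series_le_l2sqr F n : series (fun k => hn (F k) ^+ 2) n <= l2sqr F.
Proof.
by apply: nneg_series_le_lim; [move=> k; exact: sqr_ge0|exact: l2valP].
Qed.

Lemma hn_le_l2sqr F k : hn (F k) ^+ 2 <= l2sqr F.
Proof.
apply: le_trans (series_le_l2sqr F k.+1); rewrite /series/= big_nat_recr//=.
by rewrite lerDr sumr_ge0// => i _; exact: sqr_ge0.
Qed.

Lemma l2sqr_ge0 F : 0 <= l2sqr F.
Proof. by apply: le_trans (hn_le_l2sqr F 0%N); exact: sqr_ge0. Qed.

Lemma l2sqr_le F (M : R) : (forall n, series (fun k => hn (F k) ^+ 2) n <= M) ->
  l2sqr F <= M.
Proof. by move=> FM; apply: limr_le; [exact: l2valP|exact: nearW]. Qed.

Lemma l2sqr_eq0 F : l2sqr F = 0 -> F = 0.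
Proof.
move=> F0; apply: l2sum_ext => k; apply/hn_eq0/eqP.
by rewrite -sqrf_eq0 eq_le sqr_ge0 -F0 hn_le_l2sqr.
Qed.

(** The imaginary part is recovered as in [Im_hdot], so only series of real numbers are summed. *)
Definition l2dot F K : R[i] := l2rdot F K +i* l2rdot F ('i *: K).

Lemma l2rdotZlc (a : R[i]) F K :
  l2rdot (a *: F) K = Re a * l2rdot F K - Im a * l2rdot F ('i *: K).
Proof.
rewrite {1}[a]complexE scalerDl mulrC -scalerA l2rdotDl !l2rdotZl l2rdot_i.
by rewrite mulrN.
Qed.

Lemma l2dotC F K : l2dot F K = (-1) ^+ false * Num.conj (l2dot K F).
Proof.
rewrite expr0 mul1r conjCE /l2dot /= l2rdotC; congr (_ +i* _).
by rewrite l2rdotC l2rdot_i.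
Qed.

Lemma l2dotPl K a F F' : l2dot (a *: F + F') K = a * l2dot F K + l2dot F' K.
Proof.
apply: complex_ext; rewrite ?ReDc ?ImDc ?ReMc ?ImMc /l2dot /= l2rdotDl; congr +%R.
  exact: l2rdotZlc.
rewrite l2rdotZlc scalerA (_ : 'i * 'i = -1) ?scaleN1r; last exact: sqr_i.
by rewrite (l2rdotC _ (- K)) l2rdotNl mulrN opprK (l2rdotC K).
Qed.

Lemma l2dot_bilinear :
  bilinear_for *%R (Num.conj \; *%R : GRing.Scale.law _ _) l2dot.
Proof.
split=> [K|F] a x y; first exact: l2dotPl.
rewrite l2dotC l2dotPl rmorphD rmorphM /= expr0 mul1r; congr (_ * _ + _).
  by rewrite (l2dotC F x) expr0 mul1r.
by rewrite (l2dotC F y) expr0 mul1r.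
Qed.

End L2Sum.

Lemma dep_choice (I : Type) (T : I -> Type) (P : forall i, T i -> Prop) :
  (forall i, exists x, P i x) -> exists f : forall i, T i, forall i, P i (f i).
Proof.
by move=> e; exists (fun i => projT1 (cid (e i))) => i; exact: projT2 (cid (e i)).
Qed.

(** * Norm, completeness and separability of the Hilbert sum *)

Section L2Hilbert.
Context {R : realType}.
Variable G : nat -> hilbertType R.
Local Notation l2 := (l2sum G).
Implicit Types F K : l2.

HB.instance Definition _ := bilinear_isBilinear.Build R[i] l2 l2 R[i] *%R
  (Num.conj \; *%R : GRing.Scale.law _ _) (@l2dot R G) (@l2dot_bilinear R G).

HB.instance Definition _ := isHermitianSesquilinear.Build R[i] l2 false
  (@Num.conj R[i]) (@l2dot R G) (@l2dotC R G).

Lemma l2dotE F : l2dot F F = (l2sqr F)%:C.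
Proof.
rewrite l2sqrE /l2dot; congr (_ +i* _).
by have := l2rdot_i F F; rewrite l2rdotC; lra.
Qed.

Lemma l2dot_gt0 F : F != 0 -> 0 < l2dot F F.
Proof.
move=> F0; rewrite l2dotE ltr0c lt_def l2sqr_ge0 andbT.
by apply: contra F0 => /eqP/l2sqr_eq0 ->.
Qed.

HB.instance Definition _ := isDotProduct.Build R[i] l2 (@l2dot R G) l2dot_gt0.

Definition l2norm F : R[i] := (Num.sqrt (l2sqr F))%:C.

Lemma l2rdot_CS F K : l2rdot F K <= Num.sqrt (l2sqr F) * Num.sqrt (l2sqr K).
Proof.
apply: quadratic_CS; rewrite ?sqrtr_ge0// => t.
rewrite !sqr_sqrtr ?l2sqr_ge0//.
have := l2sqr_ge0 (F + t%:C *: K).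
rewrite !l2sqrE l2rdotDl !l2rdotDr !l2rdotZl !l2rdotZr (l2rdotC K F); lra.
Qed.

Lemma l2sqrD F K : l2sqr (F + K) = l2sqr F + 2 * l2rdot F K + l2sqr K.
Proof. rewrite !l2sqrE l2rdotDl !l2rdotDr (l2rdotC K F); ring. Qed.

Lemma l2normD F K : l2norm (F + K) <= l2norm F + l2norm K.
Proof.
rewrite /l2norm -rmorphD lecR /= -(@ler_pXn2r _ 2)//.
- rewrite sqrrD !sqr_sqrtr ?l2sqr_ge0// l2sqrD.
  by have := l2rdot_CS F K; lra.
- by rewrite nnegrE sqrtr_ge0.
- by rewrite nnegrE addr_ge0 ?sqrtr_ge0.
Qed.

Lemma l2normZ (a : R[i]) F : l2norm (a *: F) = `|a| * l2norm F.
Proof.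
rewrite /l2norm; have -> : l2sqr (a *: F) = Re `|a| ^+ 2 * l2sqr F.
  rewrite /l2sqr; apply: cvg_lim => //.
  have -> : series (fun k => hn ((a *: F) k) ^+ 2) =
      (fun n => Re `|a| ^+ 2 * series (fun k => hn (F k) ^+ 2) n).
    apply/funext => n; rewrite /series/= mulr_sumr.
    by apply: eq_bigr => k _; rewrite hnZ exprMn.
  by apply: cvgMl_tmp; exact: l2valP.
have a0 : 0 <= `|a| by [].
rewrite sqrtrM ?sqr_ge0// sqrtr_sqr rmorphM/=; congr (_ * _).
by rewrite ger0_norm -?(ge0_ReK a0)// -ler0c -(ge0_ReK a0).
Qed.

Lemma l2norm_eq0 F : l2norm F = 0 -> F = 0.
Proof.
move=> /complexI/eqP; rewrite sqrtr_eq0 => F0; apply: l2sqr_eq0.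
by apply/eqP; rewrite eq_le F0 l2sqr_ge0.
Qed.

HB.instance Definition _ := Lmodule_isNormed.Build R[i] l2 l2normD l2normZ l2norm_eq0.

Lemma l2_normE F : `|F| = (Num.sqrt (l2sqr F))%:C.
Proof. by []. Qed.

Lemma l2norm_le F (e : R) : 0 <= e -> (`|F| <= e%:C) = (l2sqr F <= e ^+ 2).
Proof.
move=> e0; rewrite l2_normE lecR -(@ler_pXn2r _ 2)// ?nnegrE ?sqrtr_ge0//.
by rewrite sqr_sqrtr// l2sqr_ge0.
Qed.

(** The limit is taken coordinatewise; bounds on partial sums, uniform in their length, make it a
    limit in norm. *)
Lemma l2_complete (u : nat -> l2) :
  (forall e : R, 0 < e -> exists N, forall m n, (N <= m)%N -> (N <= n)%N ->
    `|u m - u n| <= e%:C) ->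
  exists l, forall e : R, 0 < e -> exists N, forall n, (N <= n)%N ->
    `|u n - l| <= e%:C.
Proof.
move=> cu.
have /dep_choice[l ul] k :
    exists x, hn (u n k - x) @[n --> \oo] --> (0 : R).
  apply: hn_complete => e e0; have [N Ne] := cu _ e0; exists N => m n Nm Nn.
  rewrite -(@ler_pXn2r _ 2)// ?nnegrE ?hn_ge0 ?(ltW e0)//.
  have := Ne m n Nm Nn; rewrite l2norm_le; last exact: ltW.
  exact: (le_trans (hn_le_l2sqr (u m - u n) k)).
have tail (e : R) : 0 < e -> exists N, forall n, (N <= n)%N ->
    forall p, series (fun k => hn (u n k - l k) ^+ 2) p <= e ^+ 2.
  move=> e0; have [N Ne] := cu _ e0; exists N => n Nn p.
  (* For fixed [p] the sum is finite, so [m] can tend to infinity in the Cauchy estimate. *)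
  have cv : (\sum_(0 <= k < p) hn (u m k - u n k) ^+ 2) @[m --> \oo] -->
      \sum_(0 <= k < p) hn (l k - u n k) ^+ 2.
    apply: cvg_big => [|k _]; first exact: add_continuous.
    by apply: cvgM; exact: cvg_hnB.
  rewrite /series/=; under eq_bigr do rewrite hnC.
  apply: (cvgr_to_le cv); exists N => // m /= Nm.
  have := Ne m n Nm Nn; rewrite l2norm_le; last exact: ltW.
  exact: (le_trans (series_le_l2sqr (u m - u n) p)).
have [N N1] := tail 1 ltr01.
have sl : square_summable (fun k => u N k - l k).
  apply: (@is_cvg_nneg_series _ _ (1 ^+ 2)) => [k|p]; first exact: sqr_ge0.
  exact: N1.
(* Square summability of the coordinatewise limit comes from subtracting a square summable family
   from [u N]. *)
pose L : l2 := u N - L2Sum sl.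
have LE k : L k = l k by rewrite /= opprB addrC subrK.
exists L => e e0; have [M Me] := tail _ e0; exists M => n Mn.
rewrite l2norm_le; last exact: ltW.
apply: l2sqr_le => p; have := Me n Mn p.
by congr (_ <= _); apply: eq_bigr => k _; rewrite -LE.
Qed.

HB.instance Definition _ :=
  Uniform_isComplete.Build l2 (complete_of_sequences l2_complete).

Lemma l2_sqr_norm F : `|F| ^+ 2 = l2dot F F.
Proof. by rewrite l2_normE l2dotE -rmorphXn/= sqr_sqrtr ?l2sqr_ge0. Qed.

Lemma dense_enum (H : hilbertType R) :
  exists s : nat -> H, forall x (e : R), 0 < e -> exists n, hn (s n - x) < e.
Proof.
have [S cS dS] := @hilbert_separable R H.
have ball_S x (e : R) : 0 < e -> exists2 y, S y & hn (y - x) < e.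
  move=> e0; have [| | y] := dS (ball x e%:C).
  - by exists x; apply: ballxx; rewrite ltr0c.
  - exact: ball_open.
  by rewrite -ball_normE => -[/= xy Sy]; exists y => //; rewrite hnC -ltcR -normE.
have [f finj] : exists f : H -> nat, {in S &, injective f}.
  by have /countable_injP[f finj] := cS; exists f.
exists (fun n => xget 0 [set y | S y /\ f y = n]) => x e /(ball_S x)[y Sy yx].
exists (f y); suff -> : xget 0 [set z | S z /\ f z = f y] = y by [].
by case: xgetP => [z _ [Sz]|/(_ y)[]//]; apply: finj; rewrite inE.
Qed.

Lemma l2_tail F (e : R) : 0 < e ->
  exists N, forall n, (N <= n)%N ->
    l2sqr F - series (fun k => hn (F k) ^+ 2) n <= e.
Proof.
move=> e0; have /cvgrPdist_le/(_ _ e0)[N _ Ne] :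
    series (fun k => hn (F k) ^+ 2) @ \oo --> l2sqr F by exact: l2valP.
by exists N => n /Ne /(le_trans (ler_norm _)).
Qed.

Lemma l2_separable : exists2 S : set l2, countable S & dense S.
Proof.
have /dep_choice[d dP] := fun k => dense_enum (G k).
(* Finitely supported families with coordinates in the dense sequences are coded by finite lists of
   indices, hence countable. *)
pose pt (s : seq nat) k := if (k < size s)%N then d k (nth 0%N s k) else 0.
pose S := [set P : l2 | exists s, forall k, P k = pt s k].
exists S.
  apply/countable_injP.
  exists (fun P => pickle (xget [::] [set s | forall k, P k = pt s k])).
  move=> P Q; rewrite !inE => -[s Ps] [t Qt] /(pcan_inj pickleK).
  case: xgetP => [s' _ Ps'|/(_ s)//]; case: xgetP => [t' _ Qt'|/(_ t)//] st.
  by apply: l2sum_ext => k; rewrite Ps' Qt' st.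
move=> O [F OF] oO; have /nbhs_ballP[e' /gt0_ReK[e0 e'E] ballO] : nbhs F O.
  by apply: open_nbhs_nbhs.
rewrite {}e'E in ballO; move: (Re e') e0 ballO => e e0 ballO.
have [|n nF] := @l2_tail F (e ^+ 2 / 4); first by rewrite divr_gt0// exprn_gt0.
have {}nF := nF n (leqnn n).
(* The coordinates below [n] share a squared error of [e ^+ 2 / 4], and the tail beyond [n] costs as
   much again; [n.+1] keeps the divisor positive for [n = 0]. *)
pose eta := e ^+ 2 / 4 / n.+1%:R.
have eta0 : 0 < eta by rewrite !divr_gt0// exprn_gt0.
have /dep_choice[a aP] k : exists i, hn (d k i - F k) < Num.sqrt eta.
  by apply: dP; rewrite sqrtr_gt0.
pose s := mkseq a n.
have ptD p : series (fun k => hn (pt s k - F k) ^+ 2) p <= e ^+ 2 / 2.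
  (* Lengthening the sum to [p + n] terms allows a split at [n] without comparing [p] with [n]. *)
  apply: (@le_trans _ _ (series (fun k => hn (pt s k - F k) ^+ 2) (p + n)%N)).
    apply: nondecreasing_series => [k _ _|]; first exact: sqr_ge0.
    exact: leq_addr.
  rewrite series_addn /series/= (_ : e ^+ 2 / 2 = e ^+ 2 / 4 + e ^+ 2 / 4).
    apply: lerD.
      apply: (@le_trans _ _ (\sum_(0 <= k < n) eta)).
                apply: ler_sum_nat => k /= kn.
        rewrite /pt size_mkseq kn nth_mkseq// -[leRHS]sqr_sqrtr ?(ltW eta0)//.
        by rewrite ler_pXn2r ?nnegrE ?hn_ge0 ?sqrtr_ge0// ltW.
      rewrite sumr_const_nat subn0 /eta -[leLHS]mulr_natr -mulrA ler_piMr//.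
        by rewrite divr_ge0// sqr_ge0.
      by rewrite mulrC ler_pdivrMr// mul1r ler_nat.
    apply: le_trans nF; rewrite lerBrDr addrC.
    have := series_le_l2sqr F (p + n)%N; rewrite series_addn.
    apply: le_trans; rewrite lerD2l; apply: ler_sum_nat => k /andP[nk _].
    by rewrite /pt size_mkseq ltnNge nk/= sub0r hnN.
  by field.
have sD : square_summable (fun k => pt s k - F k).
  by apply: (@is_cvg_nneg_series _ _ (e ^+ 2 / 2)) => // k; exact: sqr_ge0.
(* Writing the approximating point as [F] plus the difference lets [ptD] give both its summability
   and its distance from [F]. *)
exists (F + L2Sum sD); split; last first.
  by exists s => k /=; rewrite addrC subrK.
apply: ballO; rewrite -ball_normE/= opprD addrA subrr sub0r normrN l2_normE ltcR.
rewrite -(ltr_pXn2r (ltn0Sn 1)) ?nnegrE ?sqrtr_ge0 ?(ltW e0)//.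
rewrite sqr_sqrtr ?l2sqr_ge0//.
have /le_lt_trans := @l2sqr_le _ _ (L2Sum sD) _ ptD; apply.
by have := exprn_gt0 2 e0; lra.
Qed.

HB.instance Definition _ := isSeparableHilbert.Build R l2
  l2_sqr_norm l2_separable.

End L2Hilbert.

(** * Isometric dilation and the parent space *)

Section Embedding.
Context {R : realType}.
Variable G : nat -> hilbertType R.
Local Notation l2 := (l2sum G).

Lemma l2_rdotE (F K : l2) : rdot F K = l2rdot F K.
Proof. by []. Qed.

Lemma l2_sqr_hn (F : l2) : hn F ^+ 2 = l2sqr F.
Proof. by rewrite sqr_hn l2_rdotE l2sqrE. Qed.

Variable k : nat.

Definition coord_fun (x : G k) : forall j, G j :=
  @eqtype.dfwith nat (fun j => G j) (fun=> 0) k x.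

Lemma coord_fun_summable x : square_summable (coord_fun x).
Proof.
apply: (@is_cvg_nneg_series _ _ (hn x ^+ 2)) => [j|n]; first exact: sqr_ge0.
rewrite (@series_single _ k) => [|j jk]; last first.
  by rewrite /coord_fun dfwith_out ?hn0 ?expr0n// eq_sym.
by case: ifP; rewrite /coord_fun ?dfwith_in ?sqr_ge0.
Qed.

Definition coord_emb x : l2 := L2Sum (@coord_fun_summable x).

Lemma coord_embE x : coord_emb x k = x.
Proof. by rewrite /= /coord_fun dfwith_in. Qed.

Lemma coord_emb_neq x j : j != k -> coord_emb x j = 0.
Proof. by move=> jk; rewrite /= /coord_fun dfwith_out// eq_sym. Qed.

Lemma linear_coord_emb : linear coord_emb.
Proof.
move=> a x y; apply: l2sum_ext => j; have [->|jk] := eqVneq j k.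
  by rewrite -[RHS]/(a *: coord_emb x k + coord_emb y k) !coord_embE.
rewrite -[RHS]/(a *: coord_emb x j + coord_emb y j) !coord_emb_neq//.
by rewrite scaler0 addr0.
Qed.

Lemma rdot_coord_emb x (F : l2) : rdot (coord_emb x) F = rdot x (F k).
Proof.
rewrite l2_rdotE; apply: l2rdotE; apply/cvgrPdist_le => e e0.
exists k.+1 => // n kn; rewrite (@series_single _ k) => [|j jk].
  by rewrite kn coord_embE subrr normr0 ltW.
by rewrite coord_emb_neq// rdot0l.
Qed.

Lemma hdot_coord_emb x (F : l2) : hdot (coord_emb x) F = hdot x (F k).
Proof. by apply: rdot_hdot; rewrite rdot_coord_emb. Qed.

Lemma hn_coord_emb x : hn (coord_emb x) = hn x.
Proof.
apply/eqP; rewrite -(@eqrXn2 _ 2)// ?hn_ge0// !sqr_hn rdot_coord_emb.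
by rewrite coord_embE.
Qed.

End Embedding.

(** * Isometric dilation of a contraction *)

Section Defect.
Context {R : realType} {H H' : hilbertType R}.
Variable J : {linear H -> H'}.
Hypothesis J1 : forall x, hn (J x) <= hn x.

Let lJ : linear J. Proof. exact: linearP. Qed.

Let J1b : op_bound J 1. Proof. by move=> x; rewrite mul1r. Qed.

(* The polynomials [p_0 = 1 - t], [p_(k+1) = p_k - p_k ^ 2] satisfy
   [1 - t = \sum_k p_k(t) ^ 2] on [0, 1]. Evaluating them at [J^* J] yields
   an isometric dilation of [J] without operator square roots. *)
Fixpoint defect (k : nat) (x : H) : H :=
  if k is k'.+1 then defect k' x - defect k' (defect k' x)
  else x - adjoint J (J x).

Lemma defect_props k :
  [/\ linear (defect k),
      forall x y, rdot (defect k x) y = rdot x (defect k y) &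
      forall x, 0 <= rdot (defect k x) x <= hn x ^+ 2].
Proof.
elim: k => [|k [lF sF F01]] /=.
  have la := linear_adjoint lJ J1b.
  have aE x y : rdot (adjoint J (J x)) y = rdot (J x) (J y).
    by rewrite rdotC -(rdot_adjoint lJ J1b) rdotC.
  split=> [a x y|x y|x].
  - by rewrite linearP la scalerBr addrACA opprD.
  - by rewrite rdotBl rdotBr aE (rdotC x (adjoint _ _)) aE (rdotC (J y)).
  rewrite rdotBl aE -!sqr_hn lerBlDr lerDl sqr_ge0 andbT subr_ge0.
  by rewrite ler_pXn2r ?nnegrE ?hn_ge0.
split=> [a x y|x y|x].
- by rewrite !lF scalerBr addrACA opprD.
- by rewrite rdotBl rdotBr !sF.
have FF : rdot (defect k (defect k x)) x = hn (defect k x) ^+ 2.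
  by rewrite sF sqr_hn.
(* Writing [D] for [defect k], [D - D^2 = D (1 - D)^2 + (D^2 - D^3)] is a sum of two nonnegative
   operators, and [D - D^2 <= D <= 1]. *)
have /andP[h1 h2] := F01 (defect k x).
have /andP[h3 _] := F01 (x - defect k x).
have /andP[h4 h5] := F01 x.
move: h3; rewrite linear_sub// rdotBl !rdotBr FF -(sqr_hn (defect k x)) => h3.
have := sqr_ge0 (hn (defect k x)).
rewrite rdotBl FF => h6; apply/andP; split; lra.
Qed.

(** The sum telescopes: by symmetry of [defect k], each term is the difference of the quadratic
    forms of [defect k] and [defect k.+1] at [x]. *)
Lemma defect_series x n :
  series (fun k => hn (defect k x) ^+ 2) n =
  hn x ^+ 2 - hn (J x) ^+ 2 - rdot (defect n x) x.
Proof.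
rewrite /series/=; elim: n => [|n IHn].
  rewrite big_geq//= rdotBl (rdotC (adjoint _ _)) -(rdot_adjoint lJ J1b).
  by rewrite -!sqr_hn subrr.
have [_ sF _] := defect_props n.
rewrite big_nat_recr//= IHn rdotBl (sF (defect n x)) (sqr_hn (defect n x)); ring.
Qed.

Lemma defect_cvg x : square_summable (fun k => defect k x).
Proof.
apply: (@is_cvg_nneg_series _ _ (hn x ^+ 2)) => [k|n]; first exact: sqr_ge0.
rewrite defect_series; have [_ _ /(_ x)/andP[h _]] := defect_props n.
by have := sqr_ge0 (hn (J x)); lra.
Qed.

Definition defect_emb x : l2sum (fun=> H) := L2Sum (@defect_cvg x).

Lemma linear_defect_emb : linear defect_emb.
Proof.
move=> a x y; apply: l2sum_ext => k /=.
by have [-> _ _] := defect_props k.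
Qed.

(** The remainder in [defect_series] vanishes in the limit: [defect n x] tends to [0], its squared
    norms being the terms of a convergent series. *)
Lemma sqr_hn_defect_emb x : hn (defect_emb x) ^+ 2 = hn x ^+ 2 - hn (J x) ^+ 2.
Proof.
rewrite l2_sqr_hn; apply: cvg_lim => //.
rewrite (_ : series _ = fun n => hn x ^+ 2 - hn (J x) ^+ 2 - rdot (defect n x) x);
  last by apply/funext => n; rewrite -defect_series.
rewrite -[X in _ --> X]subr0; apply: cvgB; first exact: cvg_cst.
have sq0 : hn (defect n x) ^+ 2 @[n --> \oo] --> (0 : R).
  exact: (cvg_series_cvg_0 (@defect_cvg x)).
have x0 := hn_ge0 x.
apply/cvgrPdist_le => e e0.
have d0 : 0 < (e / (hn x + 1)) ^+ 2 by rewrite exprn_gt0// divr_gt0//; lra.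
move/cvgrPdist_le : sq0 => /(_ _ d0); apply: filterS => n.
rewrite !sub0r !normrN ger0_norm ?sqr_ge0//.
rewrite ler_pXn2r ?nnegrE ?hn_ge0//; last by rewrite divr_ge0 ?ltW//; lra.
rewrite ler_pdivlMr; last by lra.
move=> h; apply: le_trans (normr_rdot_CS _ _) _.
by have := hn_ge0 (defect n x); nra.
Qed.

End Defect.

Lemma parent_space {R : realType} (H : nat -> hilbertType R) (Hoo : hilbertType R)
    (J : forall n, {linear H n -> Hoo}) (J1 : forall n x, hn (J n x) <= hn x) :
  exists (K : hilbertType R) (iota : forall n, {linear H n -> K})
    (iotaoo : {linear Hoo -> K}),
  [/\ forall n x, hn (iota n x) = hn x, forall y, hn (iotaoo y) = hn y &
      forall n x y, hdot (iota n x) (iotaoo y) = hdot (J n x) y].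
Proof.
(* Slot [0] is [Hoo] and slot [n.+1] receives the defect of [J n]. As the latter is orthogonal to
   slot [0], inner products with the image of [Hoo] see only [J n x]. *)
pose G (k : nat) : hilbertType R := if k is n.+1 then l2sum (fun=> H n) else Hoo.
pose ioo : Hoo -> l2sum G := @coord_emb _ G 0%N.
pose io n (x : H n) : l2sum G :=
  ioo (J n x) + @coord_emb _ G n.+1 (defect_emb (J1 n) x).
have lioo : linear ioo by exact: (@linear_coord_emb _ G 0%N).
have lio n : linear (io n).
  move=> a x y; rewrite /io linearP lioo linear_defect_emb.
  rewrite (@linear_coord_emb _ G n.+1).
  by rewrite scalerDr addrACA.
pose Lioo : {linear Hoo -> l2sum G} :=
  HB.pack ioo (GRing.isLinear.Build _ _ _ _ _ lioo).
pose Lio n : {linear H n -> l2sum G} :=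
  HB.pack (io n) (GRing.isLinear.Build _ _ _ _ _ (lio n)).
exists (l2sum G), Lio, Lioo; split => [n x|y|n x y] /=.
- apply/eqP; rewrite -(@eqrXn2 _ 2)// ?hn_ge0// sqr_hnD.
  rewrite !(@hn_coord_emb _ G) sqr_hn_defect_emb.
  rewrite (@rdot_coord_emb _ G) (@coord_emb_neq _ G)// rdot0r.
  by apply/eqP; ring.
- exact: (@hn_coord_emb _ G).
rewrite hdotDl (@hdot_coord_emb _ G n.+1) (@coord_emb_neq _ G)// linear0r addr0.
by rewrite (@hdot_coord_emb _ G) (@coord_embE _ G).
Qed.

(** * Resolvents and convergence *)

Section LinearClosure.
Context {R : realType} {U V W : hilbertType R}.

Lemma linear_comp (S : V -> W) (T : U -> V) : linear S -> linear T ->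
  linear (fun x => S (T x)).
Proof. by move=> lS lT a x y; rewrite lT lS. Qed.

Lemma linear_subf (S T : U -> V) : linear S -> linear T ->
  linear (fun x => S x - T x).
Proof. by move=> lS lT a x y; rewrite lS lT scalerBr addrACA opprD. Qed.

End LinearClosure.

(** * Uniqueness of adjoints, and adjoints of isometries *)

Section AdjointTheory.
Context {R : realType}.
Implicit Types U V : hilbertType R.

Lemma adjoint_unique U V (T : U -> V) (S : V -> U) c : linear T -> op_bound T c ->
  (forall x y, hdot (T x) y = hdot x (S y)) -> adjoint T = S.
Proof.
move=> lT Tc TS; apply/funext => y; apply: hdot_ext => x.
by rewrite -(hdot_adjoint lT Tc).
Qed.

Section Isometry.
Context {U V : hilbertType R} (T : U -> V).
Hypotheses (lT : linear T) (isoT : forall x, hn (T x) = hn x).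

Lemma isometry_bound : op_bound T 1.
Proof. by move=> x; rewrite isoT mul1r. Qed.

Lemma isometry_rdot x y : rdot (T x) (T y) = rdot x y.
Proof.
have := isoT (x + y) => /(congr1 (fun t => t ^+ 2)).
by rewrite linear_add// !sqr_hnD !isoT; lra.
Qed.

Lemma isometry_linear_adjoint : linear (adjoint T).
Proof. exact: linear_adjoint lT isometry_bound. Qed.

Lemma isometry_hdot_adjoint x y : hdot (T x) y = hdot x (adjoint T y).
Proof. exact: (hdot_adjoint lT isometry_bound). Qed.

Lemma isometry_rdot_adjoint x y : rdot (T x) y = rdot x (adjoint T y).
Proof. exact: (rdot_adjoint lT isometry_bound). Qed.

Lemma isometry_adjoint_le y : hn (adjoint T y) <= hn y.
Proof.
by rewrite -[leRHS]mul1r; exact: (adjoint_bound lT isometry_bound).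
Qed.

Lemma isometry_adjointK x : adjoint T (T x) = x.
Proof.
apply/subr0_eq/hn_eq0/eqP; rewrite -sqrf_eq0 sqr_hn rdotBr.
by rewrite -isometry_rdot_adjoint isometry_rdot subrr.
Qed.

(** Pythagoras for the orthogonal projection [T T^*] onto the range of [T]. *)
Lemma isometry_sqr_proj v :
  hn (v - T (adjoint T v)) ^+ 2 = hn v ^+ 2 - hn (adjoint T v) ^+ 2.
Proof.
rewrite sqr_hnB (rdotC v) isometry_rdot_adjoint -sqr_hn isoT; ring.
Qed.

Lemma isometry_proj_le v : hn (v - T (adjoint T v)) <= hn v.
Proof.
rewrite -(@ler_pXn2r _ 2)// ?nnegrE ?hn_ge0// isometry_sqr_proj.
by rewrite lerBlDr lerDl sqr_ge0.
Qed.

End Isometry.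
End AdjointTheory.

(** * Linearity, boundedness and self-adjointness of resolvents *)

Section Resolvent.
Context {R : realType} {H : hilbertType R} (A : operator H) (z : R[i]).
Hypothesis Az : resolvent_set A z.

Let S := resolvent A z.

Lemma resolvent_dom y : dom A (S y).
Proof.
case: Az => -[_ injA surjA] _; have [x Ax xy] := surjA y I.
rewrite /S /resolvent -xy pinvKV//; exact: mem_set.
Qed.

Lemma resolventK y : A (S y) - z *: S y = y.
Proof.
case: Az => -[_ injA surjA] _; have [x Ax xy] := surjA y I.
by rewrite /S /resolvent -{3}xy -xy pinvKV//; exact: mem_set.
Qed.

Lemma resolvent_uniq x y : dom A x -> A x - z *: x = y -> S y = x.
Proof.
case: Az => -[_ injA _] _ Ax xy; apply: injA; rewrite ?inE//.
  exact: resolvent_dom.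
by rewrite resolventK xy.
Qed.

Lemma linear_resolvent : linear S.
Proof.
move=> a x y; have Dx := resolvent_dom x; have Dy := resolvent_dom y.
apply: resolvent_uniq; first exact: dom_linear.
rewrite op_linear// -{3}(resolventK x) -{3}(resolventK y).
by rewrite scalerDr scalerBr !scalerA (mulrC z) addrACA opprD.
Qed.

Lemma resolvent_bounded : exists2 c, 0 <= c & op_bound S c.
Proof. by case: Az => _; exact: bounded_opP linear_resolvent. Qed.

(** For real [z] the operator [A - z] is symmetric on its domain, hence so is its inverse. This
    supplies the adjoint bounds that [que_cvg] states for nonreal points only. *)
Lemma resolvent_adjoint : self_adjoint A -> z \is Num.real -> adjoint S = S.
Proof.
move=> [_ AA] /complex_realP[t zt]; have [c _ Sc] := resolvent_bounded.
apply: (adjoint_unique linear_resolvent Sc) => x y.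
have : adjoint_graph A (S y, A (S y)).
  by rewrite AA; split => //=; exact: resolvent_dom.
move=> /(_ (S x) (resolvent_dom x))/= sym.
rewrite -{2}(resolventK x) -{1}(resolventK y) hdotDl hdotDr sym; congr +%R.
by rewrite linearNl linearNr/= hdotZl hdotZr zt conjCE /= oppr0.
Qed.

End Resolvent.

(** * From close lifted resolvents to quasi-unitary bounds, for one index *)

Section WeidmannBounds.
Context {R : realType} {K : hilbertType R}.

(** With [D = i S i^* - j T j^*], the defect is [i^* (1 - j j^* ) i S = i^* (1 - j j^* ) D i],
    because [1 - j j^*] kills the range of [j]; all factors besides [D] are contractions. Exchanging
    [i] and [j] gives the other defect. *)
Lemma weidmann_defect (U V : hilbertType R) (i : U -> K) (j : V -> K)
    (S : U -> U) (T : V -> V) (d : R) :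
  linear i -> linear j -> (forall x, hn (i x) = hn x) ->
  (forall x, hn (j x) = hn x) ->
  op_bound (fun k => i (S (adjoint i k)) - j (T (adjoint j k))) d ->
  op_bound (fun x => S x - adjoint i (j (adjoint j (i (S x))))) d.
Proof.
move=> li lj isoi isoj Dd x.
rewrite -{1}(isometry_adjointK li isoi (S x)).
rewrite -(linear_sub _ _ (isometry_linear_adjoint li isoi)).
apply: le_trans (isometry_adjoint_le li isoi _) _.
rewrite -(isoi x); apply: le_trans (Dd (i x)).
rewrite (isometry_adjointK li isoi).
apply: le_trans (isometry_proj_le lj isoj _).
rewrite (linear_sub _ _ (isometry_linear_adjoint lj isoj)).
rewrite (isometry_adjointK lj isoj) (linear_sub _ _ lj).
by rewrite opprB addrA subrK.
Qed.

(** [S] and [T] are kept general in order to cover the resolvents and their adjoints alike. *)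
Lemma weidmann_quasi_unitary (H : nat -> hilbertType R) (n : nat)
    (V : hilbertType R) (i : H n -> K) (j : V -> K)
    (S : H n -> H n) (T : V -> V) (d : R) : 0 <= d ->
  linear i -> linear j -> (forall x, hn (i x) = hn x) ->
  (forall x, hn (j x) = hn x) ->
  op_bound (fun k => i (S (adjoint i k)) - j (T (adjoint j k))) d ->
  @quasi_unitary_bounds R H V n (fun x => adjoint j (i x)) d S T.
Proof.
move=> d0 li lj isoi isoj Dd.
have lij := linear_comp (isometry_linear_adjoint lj isoj) li.
have bij : op_bound (fun x => adjoint j (i x)) 1.
  by move=> x; rewrite mul1r -(isoi x) isometry_adjoint_le.
have adJ : adjoint (fun x => adjoint j (i x)) = (fun y => adjoint i (j y)).
  apply: (adjoint_unique lij bij) => x y.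
  rewrite -(isometry_hdot_adjoint li isoi).
  by rewrite hdotC -(isometry_hdot_adjoint lj isoj) -hdotC.
rewrite /quasi_unitary_bounds adJ; split; apply: opnorm_le => //.
- exact: weidmann_defect Dd.
- by apply: (weidmann_defect (T := S)) => // k; rewrite hnC.
(* The commutator [T J - J S] equals [- j^* D i], where [D] is the difference of the lifted
   operators. *)
move=> x; rewrite -(isoi x); apply: le_trans (Dd (i x)).
rewrite hnC (isometry_adjointK li isoi) -{1}(isometry_adjointK lj isoj (T _)).
rewrite -(linear_sub _ _ (isometry_linear_adjoint lj isoj)).
exact: isometry_adjoint_le.
Qed.

End WeidmannBounds.

(** * From quasi-unitary bounds to close lifted resolvents, for one index *)

Lemma le_add_root {R : realFieldType} (q e r : R) : 0 <= q -> 0 <= e ->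
  r ^+ 2 <= q ^+ 2 + e * r -> r <= q + e.
Proof.
move=> q0 e0 rqe; have [//|lt_r] := leP r (q + e); exfalso.
(* If [r > q + e], then [r * (r - e) > r * q >= q ^+ 2], against the hypothesis. *)
have r0 : 0 < r by lra.
have h1 : r * q < r * (r - e) by rewrite ltr_pM2l//; lra.
have h2 : q * q <= r * q by rewrite ler_wpM2r//; lra.
lra.
Qed.

Section OneStep.
Context {R : realType} {U V K : hilbertType R}.
Variables (i : U -> K) (j : V -> K) (J : U -> V) (S : U -> U) (T : V -> V).
Variables (d M : R).
Hypotheses (li : linear i) (lj : linear j) (lJ : linear J) (lT : linear T).
Hypotheses (isoi : forall x, hn (i x) = hn x) (isoj : forall x, hn (j x) = hn x).
Hypotheses (d0 : 0 <= d) (M0 : 0 <= M).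
Hypotheses (Jd : op_bound J (1 + d)) (TM : op_bound T M).
Hypothesis ij : forall x y, hdot (i x) (j y) = hdot ((1 + d)^-1%:C *: J x) y.
Hypothesis JS : op_bound (fun x => S x - adjoint J (J (S x))) d.
Hypothesis JT :
  op_bound (fun y => adjoint T y - J (adjoint J (adjoint T y))) d.
Hypothesis TJ : op_bound (fun x => T (J x) - J (S x)) d.

Let d1 : 0 < 1 + d. Proof. by move: d0; lra. Qed.

Let J' x := (1 + d)^-1%:C *: J x.

Let rJ := rdot_adjoint lJ Jd.

Let rT := rdot_adjoint lT TM.

Let B := M * (1 + d) + 2 * d.

Let B0 : 0 <= B.
Proof. by rewrite /B addr_ge0 ?mulr_ge0// ltW. Qed.

(** A bound on [S] in terms of [M] and [d] alone is what makes the final estimate uniform in [n].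
    The commutator bounds [J S x] by [(B - d) * hn x], and the squared norm of [S x] exceeds that of
    [J S x] by at most [d * hn x * hn (S x)]; [le_add_root] then solves for [hn (S x)]. *)
Lemma que_resolvent_bound : op_bound S B.
Proof.
move=> x; set r := hn (S x); set s := hn x.
have r0 : 0 <= r := hn_ge0 _; have s0 : 0 <= s := hn_ge0 _.
have JSx : hn (J (S x)) <= (B - d) * s.
  rewrite (_ : J (S x) = T (J x) - (T (J x) - J (S x))); last first.
    by rewrite opprB addrC subrK.
  apply: le_trans (hnB _ _) _.
  have := TM (J x); have := ler_wpM2l M0 (Jd x); have := TJ x.
  rewrite -/s /B; nra.
have Bd0 : 0 <= B - d by rewrite /B; have := mulr_ge0 M0 (ltW d1); move: d0; lra.
have rr : r ^+ 2 <= ((B - d) * s) ^+ 2 + d * s * r.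
  rewrite {1}/r sqr_hn -{1}(subrK (adjoint J (J (S x))) (S x)) rdotDl.
  rewrite addrC lerD//.
    rewrite rdotC -rJ -sqr_hn ler_pXn2r ?nnegrE ?hn_ge0//.
    exact: mulr_ge0.
  apply: le_trans (rdot_CS _ _) _.
  by rewrite ler_wpM2r// JS.
have := le_add_root (mulr_ge0 Bd0 s0) (mulr_ge0 d0 s0) rr.
by rewrite -mulrDl subrK.
Qed.

(* The cost of replacing [J] by the contraction [J / (1 + d)]. *)
Let rescale (a b c : R) : 0 <= b -> b <= (1 + d) ^+ 2 * a -> a - b <= c ->
  a - ((1 + d)^-1) ^+ 2 * b <= c + ((1 + d) ^+ 2 - 1) * a.
Proof.
move=> b0 ba abc; rewrite exprVn.
have : 1 <= (1 + d) ^+ 2 by rewrite exprn_ege1//; move: d0; lra.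
move: ((1 + d) ^+ 2) ba => t ba t1; have t0 : 0 < t by lra.
have : b * (1 - t^-1) <= t * a * (1 - t^-1).
  by rewrite ler_wpM2r// subr_ge0 invf_le1.
have -> : t * a * (1 - t^-1) = t * a - a by field; rewrite gt_eqF.
lra.
Qed.

(** Under each root, the first term comes from the defect of [J] (for [e1]) or of [J^*] (for [e2]),
    the second from [rescale]. *)
Let e1 := Num.sqrt (d * B + ((1 + d) ^+ 2 - 1) * B ^+ 2).
Let e2 := Num.sqrt (d * M + ((1 + d) ^+ 2 - 1) * M ^+ 2).

Let gap0 : 0 <= (1 + d) ^+ 2 - 1.
Proof. by rewrite subr_ge0 exprn_ege1//; move: d0; lra. Qed.

Let sqrt_bound (a c s : R) : 0 <= a -> 0 <= s -> 0 <= c ->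
  a ^+ 2 <= c * s ^+ 2 -> a <= Num.sqrt c * s.
Proof.
move=> a0 s0 c0 acs; rewrite -(@ler_pXn2r _ 2)// ?nnegrE ?mulr_ge0 ?sqrtr_ge0//.
by rewrite exprMn sqr_sqrtr.
Qed.

Let lJ' : linear J'.
Proof. by move=> a x y; rewrite /J' lJ scalerDr !scalerA mulrC. Qed.

Let rij x y : rdot (i x) (j y) = rdot (J' x) y.
Proof. by rewrite /rdot ij. Qed.

(** As [j^* i = J'], this vector is [(1 - j j^* ) i S x], and its squared norm is the difference of
    those of [S x] and [J' (S x)]. *)
Lemma que_range_defect x : hn (i (S x) - j (J' (S x))) <= e1 * hn x.
Proof.
have Sx := que_resolvent_bound x.
have x0 := hn_ge0 x; have Sx0 := hn_ge0 (S x).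
apply: sqrt_bound; rewrite ?hn_ge0//.
  by rewrite addr_ge0 ?mulr_ge0// exprn_ge0.
rewrite sqr_hnB rij isoi isoj -sqr_hn.
rewrite (_ : _ - _ + _ = hn (S x) ^+ 2 - hn (J' (S x)) ^+ 2); last by ring.
rewrite {1}/J' hnZr ger0_norm ?invr_ge0 ?(ltW d1)// exprMn.
apply: (le_trans (@rescale _ _ (d * B * hn x ^+ 2) _ _ _)).
- exact: sqr_ge0.
- rewrite -exprMn ler_pXn2r ?nnegrE ?hn_ge0//.
  by rewrite mulr_ge0// (ltW d1).
- rewrite !sqr_hn rJ -rdotBr.
  apply: le_trans (rdot_CS _ _) _.
  have h1 := JS x; have h2 := hn_ge0 (S x - adjoint J (J (S x))).
  apply: le_trans (ler_pM Sx0 h2 Sx h1) _.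
  by rewrite -(sqr_hn x) le_eqVlt; apply/orP; left; apply/eqP; ring.
rewrite [leRHS]mulrDl lerD2l -mulrA ler_wpM2l// -exprMn.
by rewrite ler_pXn2r ?nnegrE ?mulr_ge0.
Qed.

Let J'b : op_bound J' 1.
Proof.
move=> x; rewrite /J' hnZr ger0_norm ?invr_ge0 ?(ltW d1)// mul1r mulrC.
by rewrite ler_pdivrMr// mulrC; exact: Jd.
Qed.

Let adjJ' y : adjoint J' y = (1 + d)^-1%:C *: adjoint J y.
Proof.
apply: hdot_ext => x; rewrite -(hdot_adjoint lJ' J'b) /J' hdotZl hdotZr.
by rewrite (hdot_adjoint lJ Jd) conjCE /= oppr0.
Qed.

(** The same computation with [i] and [j] exchanged: [i^* j] is the adjoint of [J']. *)
Lemma que_adjoint_range_defect w :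
  hn (i (adjoint J' (adjoint T w)) - j (adjoint T w)) <= e2 * hn w.
Proof.
have aM := adjoint_bound lT TM M0 w; have w0 := hn_ge0 w.
set y := adjoint T w in aM *; have y0 := hn_ge0 y.
apply: sqrt_bound; rewrite ?hn_ge0//.
  by rewrite addr_ge0 ?mulr_ge0// exprn_ge0.
rewrite sqr_hnB rij isoi isoj (rdot_adjoint lJ' J'b) -sqr_hn.
rewrite (_ : _ - _ + _ = hn y ^+ 2 - hn (adjoint J' y) ^+ 2); last by ring.
rewrite adjJ' hnZr ger0_norm ?invr_ge0 ?(ltW d1)// exprMn.
apply: (le_trans (@rescale _ _ (d * M * hn w ^+ 2) _ _ _)).
- exact: sqr_ge0.
- rewrite -exprMn ler_pXn2r ?nnegrE ?hn_ge0 ?mulr_ge0 ?(ltW d1)//.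
  exact: (adjoint_bound lJ Jd (ltW d1) y).
- rewrite !sqr_hn -rJ (rdotC _ y) -rdotBr.
  apply: le_trans (rdot_CS _ _) _.
  have h1 := JT w; have h2 := hn_ge0 (y - J (adjoint J y)).
  apply: le_trans (ler_pM y0 h2 aM h1) _.
  by rewrite -(sqr_hn w) le_eqVlt; apply/orP; left; apply/eqP; ring.
rewrite [leRHS]mulrDl lerD2l -mulrA ler_wpM2l// -exprMn.
by rewrite ler_pXn2r ?nnegrE ?mulr_ge0.
Qed.

(** Duality: [T (J' i^* - j^* )] is the adjoint of the operator bounded in
    [que_adjoint_range_defect]. *)
Lemma que_corange_defect k : hn (T (J' (adjoint i k) - adjoint j k)) <= e2 * hn k.
Proof.
set w := T _; have [->|wN0] := eqVneq (hn w) 0.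
  by rewrite mulr_ge0 ?hn_ge0// sqrtr_ge0.
rewrite -(ler_pM2r (_ : 0 < hn w)) ?lt_def ?wN0 ?hn_ge0// -expr2 sqr_hn.
rewrite {1}/w rT rdotBl (rdot_adjoint lJ' J'b).
rewrite !(rdotC (adjoint _ k)) -(isometry_rdot_adjoint li isoi).
rewrite -(isometry_rdot_adjoint lj isoj) -rdotBl.
apply: le_trans (rdot_CS _ _) _; rewrite mulrAC ler_wpM2r ?hn_ge0//.
exact: que_adjoint_range_defect.
Qed.

Lemma que_parent_bound :
  op_bound (fun k => i (S (adjoint i k)) - j (T (adjoint j k))) (e1 + d + e2).
Proof.
move=> k; set x := adjoint i k.
have xk : hn x <= hn k := isometry_adjoint_le li isoi k.
rewrite (_ : _ - _ = i (S x) - j (J' (S x)) + (j (J' (S x)) - j (T (J' x)))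
  + (j (T (J' x)) - j (T (adjoint j k)))); last first.
  by rewrite !addrA !subrK.
rewrite !mulrDl; apply: le_trans (hnD _ _) _; apply: lerD; last first.
  by rewrite -!linear_sub// isoj; exact: que_corange_defect.
apply: le_trans (hnD _ _) _; apply: lerD.
  by apply: le_trans (que_range_defect x) _; rewrite ler_wpM2l// sqrtr_ge0.
(* The middle term is the commutator bounded by [TJ] times [(1 + d)^-1], a factor of at most [1]. *)
rewrite -linear_sub// isoj hnC {2}/J' /J' linear_scale// -scalerBr hnZr.
rewrite ger0_norm ?invr_ge0 ?(ltW d1)// mulrC ler_pdivrMr//.
apply: le_trans (TJ x) _; rewrite -mulrA ler_wpM2l//.
have := hn_ge0 k; move: d0; nra.
Qed.

End OneStep.

(** * The two implications *)

Section WeidmannQUE.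
Context {R : realType} {H : nat -> hilbertType R} {Hoo : hilbertType R}.
Variables (A : forall n, operator (H n)) (Aoo : operator Hoo).

Lemma isometric_hn (U V : hilbertType R) (T : U -> V) :
  isometric T <-> forall x, hn (T x) = hn x.
Proof.
by split=> h x; [rewrite /hn h|rewrite !normE h].
Qed.

Lemma weidmann_que : weidmann_cvg A Aoo -> que_cvg A Aoo.
Proof.
move=> [K [i [j [z0 [/(_ _)/isometric_hn isoi /isometric_hn isoj [zoo zA] cv]]]]].
have lj : linear j by exact: linearP.
have li n : linear (i n) by exact: linearP.
have zn n : resolvent_set (A n) z0 by exact: zA.
pose D n x := i n (resolvent (A n) z0 (adjoint (i n) x)) -
                       j (resolvent Aoo z0 (adjoint j x)).
have laj := isometry_linear_adjoint lj isoj.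
have lai n := isometry_linear_adjoint (li n) (isoi n).
have lS n := linear_resolvent (zn n).
have lT := linear_resolvent zoo.
have l1 n := linear_comp (li n) (linear_comp (lS n) (lai n)).
have l2 := linear_comp lj (linear_comp lT laj).
have lD n : linear (D n) := linear_subf (l1 n) l2.
have [M M0 TM] := resolvent_bounded zoo.
(* Finiteness makes [fine (opnorm (D n))] a faithful real value; the bound may depend on [n]. *)
have bD n : opnorm (D n) \is a fin_num.
  have [c c0 Sc] := resolvent_bounded (zn n).
  rewrite ge0_fin_numE ?opnorm_ge0//.
  apply: (@le_lt_trans _ _ (c + M)%:E); last by rewrite ltry.
  apply: opnorm_le => [|x]; first exact: addr_ge0.
  apply: le_trans (hnB _ _) _; rewrite isoi isoj mulrDl.
  have h1 := isometry_adjoint_le (li n) (isoi n) x.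
  have h2 := isometry_adjoint_le lj isoj x.
  by apply: lerD; [apply: le_trans (Sc _) _|apply: le_trans (TM _) _];
    rewrite ler_wpM2l.
pose d n := fine (opnorm (D n)).
have d0 n : 0 <= d n by apply/fine_ge0/opnorm_ge0.
have Dd n : op_bound (D n) (d n).
  by apply: opnorm_bound => //; rewrite fineK.
pose J n : {linear H n -> Hoo} := HB.pack (fun x => adjoint j (i n x))
  (GRing.isLinear.Build _ _ _ _ _ (linear_comp laj (li n))).
have J1 n : op_bound (J n) 1.
  by move=> x; rewrite mul1r -(isoi n x); exact: isometry_adjoint_le.
exists z0, d, J; split => //.
  exact: fine_cvg cv.
move=> n; have J1n : (opnorm (J n) <= 1%:E)%E by exact: opnorm_le.
split.
- by rewrite /bounded_op (le_lt_trans J1n)// ltry.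
- by apply: le_trans J1n _; rewrite lee_fin lerDl.
- exact: weidmann_quasi_unitary (Dd n).
(* The difference of the lifted adjoint resolvents is the adjoint of [D n], hence has the same bound
   [d n]. *)
move=> _; apply: weidmann_quasi_unitary => // x.
have [c c0 Sc] := resolvent_bounded (zn n).
suff <- : adjoint (D n) x =
    i n (adjoint (resolvent (A n) z0) (adjoint (i n) x)) -
    j (adjoint (resolvent Aoo z0) (adjoint j x)).
  exact: adjoint_bound (lD n) (Dd n) (d0 n) x.
rewrite (adjoint_unique (lD n) (Dd n) (S := fun x =>
    i n (adjoint (resolvent (A n) z0) (adjoint (i n) x)) -
    j (adjoint (resolvent Aoo z0) (adjoint j x))))// => {}x y.
rewrite /D linearBl linearBr/= (isometry_hdot_adjoint (li n) (isoi n)).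
rewrite (isometry_hdot_adjoint lj isoj).
rewrite (hdot_adjoint (lS n) Sc) (hdot_adjoint lT TM).
rewrite (hdot_adjointC (li n) (isometry_bound (isoi n))).
by rewrite (hdot_adjointC lj (isometry_bound isoj)).
Qed.

Lemma que_weidmann (hA : forall n, self_adjoint (A n)) (hAoo : self_adjoint Aoo) :
  que_cvg A Aoo -> weidmann_cvg A Aoo.
Proof.
move=> [z0 [d [J [[zoo zA] d0 cd que]]]].
have zn n : resolvent_set (A n) z0 by exact: zA.
have lS n := linear_resolvent (zn n).
have lT := linear_resolvent zoo.
have lJ n : linear (J n) by exact: linearP.
have Jd n : op_bound (J n) (1 + d n).
  by have [_ Jb _ _] := que n; exact: opnorm_bound.
have d1 n : 0 < 1 + d n by have := d0 n; lra.
have lJ' n : linear (fun x => (1 + d n)^-1%:C *: J n x).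
  by move=> a x y; rewrite lJ scalerDr !scalerA mulrC.
pose J' n : {linear H n -> Hoo} := HB.pack (fun x => (1 + d n)^-1%:C *: J n x)
  (GRing.isLinear.Build _ _ _ _ _ (lJ' n)).
have [n x /=|K [i [j [isoi isoj ij]]]] := @parent_space R H Hoo J'.
  rewrite hnZr ger0_norm ?invr_ge0 ?(ltW (d1 n))// mulrC ler_pdivrMr//.
  by rewrite mulrC; exact: Jd.
have lj : linear j by exact: linearP.
have li n : linear (i n) by exact: linearP.
have [M M0 TM] := resolvent_bounded zoo.
exists K, i, j, z0; split => //.
- by move=> n; apply/isometric_hn.
- by apply/isometric_hn.
have laJ n := linear_adjoint (lJ n) (Jd n).
have lJS n : linear (fun x => J n (resolvent (A n) z0 x)).
  exact: linear_comp.
have quasi n (S : H n -> H n) (T : Hoo -> Hoo) : linear S -> linear T ->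
    quasi_unitary_bounds (J n) (d n) S T ->
    [/\ op_bound (fun x => S x - adjoint (J n) (J n (S x))) (d n),
        op_bound (fun y => T y - J n (adjoint (J n) (T y))) (d n) &
        op_bound (fun x => T (J n x) - J n (S x)) (d n)].
  move=> lS' lT' [h1 h2 h3]; split; apply: opnorm_bound => //.
  - exact: linear_subf (linear_comp (laJ n) (linear_comp (lJ n) lS')).
  - exact: linear_subf (linear_comp (lJ n) (linear_comp (laJ n) lT')).
  - exact: linear_subf (linear_comp lT' (lJ n)) (linear_comp (lJ n) lS').
(* For nonreal [z0] this is part of the assumption; for real [z0] the limit resolvent is its own
   adjoint. *)
have JTa n : op_bound (fun y => adjoint (resolvent Aoo z0) y -
    J n (adjoint (J n) (adjoint (resolvent Aoo z0) y))) (d n).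
  have [_ _ q qa] := que n; have [zr|zr] := boolP (z0 \is Num.real).
    rewrite (resolvent_adjoint zoo hAoo zr).
    by have [] := quasi _ _ _ (lS n) lT q.
  have [c _ Sc] := resolvent_bounded (zn n).
  by have [] := quasi _ _ _ (linear_adjoint (lS n) Sc)
    (linear_adjoint lT TM) (qa zr).
(* The bound of [que_parent_bound] depends on [n] only through [d n], and is continuous in it with
   value [0] at [0]. *)
pose B n := M * (1 + d n) + 2 * d n.
pose gap n := (1 + d n) ^+ 2 - 1.
pose b n := Num.sqrt (d n * B n + gap n * B n ^+ 2) + d n +
            Num.sqrt (d n * M + gap n * M ^+ 2).
have Db n : op_bound (fun x => i n (resolvent (A n) z0 (adjoint (i n) x)) -
                       j (resolvent Aoo z0 (adjoint j x))) (b n).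
  have [_ _ q _] := que n; have [q1 _ q3] := quasi _ _ _ (lS n) lT q.
  exact: (que_parent_bound (li n) lj (lJ n) lT (isoi n) isoj (d0 n) M0
    (Jd n) TM (ij n) q1 (JTa n) q3).
have b0 n : 0 <= b n by rewrite !addr_ge0 ?sqrtr_ge0.
have cB : B n @[n --> \oo] --> M * (1 + 0) + 2 * 0.
  apply: cvgD; apply: cvgM; (try exact: cvg_cst) => //.
  by apply: cvgD => //; exact: cvg_cst.
have cgap : gap n @[n --> \oo] --> ((1 + 0) ^+ 2 - 1 : R).
  apply: cvgB; last exact: cvg_cst.
  by apply: cvgM; apply: cvgD => //; exact: cvg_cst.
have cb : b n @[n --> \oo] --> (0 : R).
  have -> : (0 : R) = Num.sqrt (0 * (M * (1 + 0) + 2 * 0) +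
      ((1 + 0) ^+ 2 - 1) * (M * (1 + 0) + 2 * 0) ^+ 2) + 0 +
      Num.sqrt (0 * M + ((1 + 0) ^+ 2 - 1) * M ^+ 2).
    by rewrite !addr0 expr1n subrr !mul0r addr0 sqrtr0 !addr0.
  apply: cvgD; [apply: cvgD => //|]; apply: continuous_cvg;
    (try exact: sqrt_continuous); apply: cvgD; apply: cvgM => //.
  - by apply: cvgM.
  - exact: cvg_cst.
  - exact: cvg_cst.
apply: (@squeeze_cvge _ _ _ _ (fun=> 0%E) _ (fun n => (b n)%:E)).
- apply: nearW => n; rewrite opnorm_ge0/=; exact: opnorm_le.
- exact: cvg_cst.
- by apply: cvg_EFin => //; exact: nearW.
Qed.

End WeidmannQUE.

Theorem theorem1p7 (R : realType) (H : nat -> hilbertType R)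
    (Hoo : hilbertType R) (A : forall n, operator (H n)) (Aoo : operator Hoo)
    (hA : forall n, self_adjoint (A n)) (hAoo : self_adjoint Aoo) :
  weidmann_cvg A Aoo <-> que_cvg A Aoo.
Proof. by split; [exact: weidmann_que|exact: que_weidmann]. Qed.
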